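(* The constant $e^{\pi/2}$ in the bound $\|\exp(tA)\|\le e^{-r_A(0)t+\pi/2}$ is optimal, in the sense that $$\sup\left\{ e^{r_A(0)\,t}\,\|\exp(tA)\| \;:\; -A \text{ is an } m\text{-accretive operator on a nonzero complex Hilbert space},\ t\ge 0\right\} = e^{\pi/2},$$ where for each such $A$, $r_A(0)=\left(\sup_{\operatorname{Re} z>0}\|(z-A)^{-1}\|\right)^{-1}$.
   Context: An operator $-A$ on a Hilbert space $\mathcal H$ is $m$-accretive if $A$ is closed and densely defined, $\operatorname{Re}\langle -Au,u\rangle\ge 0$ for all $u\in D(A)$, and $\lambda-A$ maps $D(A)$ onto $\mathcal H$ for every $\lambda>0$; equivalently $A$ generates a strongly continuous semigroup of contractions, denoted $\exp(tA)$, $t\ge0$. Norms of operators are operator norms on $\mathcal H$. Conventions: $\|(z-A)^{-1}\|=+\infty$ if $z$ is in the spectrum of $A$, and $1/(+\infty)=0$, so $r_A(0)\in[0,+\infty[$. The supremum is taken over all nonzero complex Hilbert spaces, all such operators $A$ and all $t\ge 0$. *)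

(* Defs.v *)
From HB Require Import structures.
From mathcomp Require Import all_boot all_order all_algebra.
From mathcomp Require Import all_classical all_reals all_analysis.
From mathcomp Require Import complex.

Set Implicit Arguments.
Unset Strict Implicit.
Unset Printing Implicit Defensive.

Import Order.TTheory GRing.Theory Num.Theory numFieldNormedType.Exports.

Local Open Scope classical_set_scope.
Local Open Scope complex_scope.
Local Open Scope ring_scope.

(* A complex Hilbert space is a complete normed R[i]-module together with an
   inner product (linear in its first argument) that induces its norm. *)
Definition hilbert_product (R : realType) (H : completeNormedModType R[i])
    (dot : {dot H for Num.conj}) :=
  forall u : H, dot u u = `|u| ^+ 2.

(* A possibly unbounded operator: the values of [opfun] outside [opdom] are
   irrelevant. *)
Record operator (R : realType) (H : completeNormedModType R[i]) := Operator {
  opdom : set H;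
  opfun :> H -> H;
  opdom0 : opdom 0;
  opdom_linear : forall (a : R[i]) (u v : H),
    opdom u -> opdom v -> opdom (a *: u + v);
  opfun_linear : forall (a : R[i]) (u v : H),
    opdom u -> opdom v -> opfun (a *: u + v) = a *: opfun u + opfun v }.

Section Operators.
Context {R : realType} {H : completeNormedModType R[i]}.
Implicit Type A : operator H.

Definition closed_operator A :=
  closed [set p : H * H | opdom A p.1 /\ p.2 = A p.1].

(* [opp_m_accretive dot A] says that the operator -A (not A) is m-accretive. *)
Definition opp_m_accretive (dot : {dot H for Num.conj}) A :=
  [/\ closed_operator A,
      dense (opdom A),
      forall u, opdom A u -> 0 <= complex.Re (dot (- A u) u) &
      forall lambda : R, 0 < lambda ->
        forall v, exists2 u, opdom A u & lambda%:C *: u - A u = v].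

(* Norms of vectors are nonnegative elements of R[i]; [complex.Re] reads them
   as elements of R. *)
Definition opnorm (T : H -> H) : \bar R :=
  ereal_sup [set (complex.Re `|T u|)%:E | u in [set u : H | `|u| <= 1]].

(* The inverse of z - A : opdom A -> H, when this map is bijective. *)
Definition resolvent A (z : R[i]) (v : H) : H :=
  get [set u | opdom A u /\ z *: u - A u = v].

Definition resolvent_set A : set R[i] :=
  [set z | (forall v, exists! u, opdom A u /\ z *: u - A u = v) /\
           (opnorm (resolvent A z) < +oo)%E].

Definition spectrum A : set R[i] := ~` resolvent_set A.

Definition resolvent_norm A (z : R[i]) : \bar R :=
  if `[< spectrum A z >] then +oo%E else opnorm (resolvent A z).

(* r_A(0); in \bar R one has +oo^-1 = 0, and the supremum is positive as soon
   as H is nonzero, so that [fine] is applied to a finite value. *)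
Definition rA0 A : R :=
  fine ((ereal_sup [set resolvent_norm A z |
                      z in [set z : R[i] | 0 < complex.Re z]%R])^-1)%E.

(* Only the values of S at nonnegative times matter. *)
Definition contraction_semigroup (S : R -> {linear H -> H}) :=
  [/\ forall u, S 0 u = u,
      forall s t, 0 <= s -> 0 <= t -> forall u, S (s + t) u = S s (S t u),
      forall u, {within [set t : R | 0 <= t], continuous (fun t => S t u)} &
      forall t, 0 <= t -> forall u, `|S t u| <= `|u|].

(* A, with its exact domain, is the infinitesimal generator of S. *)
Definition generator (S : R -> {linear H -> H}) A :=
  forall u v : H, (opdom A u /\ A u = v) <->
    ((fun h : R => (h^-1)%:C *: (S h u - u)) @ 0^'+ --> v).

(* S t = exp (t A), t >= 0: such an S is determined by A. *)
Definition semigroup_of A (S : R -> {linear H -> H}) :=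
  contraction_semigroup S /\ generator S A.

End Operators.

(* Main.v *)
Require Import Defs.
From HB Require Import structures.
From mathcomp Require Import all_boot all_order all_algebra.
From mathcomp Require Import separable cyclotomic.
From mathcomp Require cyclic.
From mathcomp Require Import all_classical all_reals all_analysis.
From mathcomp Require Import complex ring lra zify.
Set Implicit Arguments.
Unset Strict Implicit.
Unset Printing Implicit Defensive.
Import Order.TTheory GRing.Theory Num.Theory numFieldNormedType.Exports.
Local Open Scope classical_set_scope.
Local Open Scope complex_scope.
Local Open Scope ring_scope.

(** Upper bound.  Write r for r_A(0) and u(t) = exp(tA) u.  For a cut-off phi
    of compact support, v = phi u solves v' - A v = phi' u, and Plancherel in
    time together with r |w| <= |(z - A) w| on the imaginary axis gives
      r^2 int phi^2 |u|^2 <= int phi'^2 |u|^2.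
    Since |u| decreases, a good choice of phi turns this into decay of |u(T)|:
    phi = sin (r s) on an arc of length pi/4, where phi'^2 - r^2 phi^2 >= 0 and
    |u| <= |u(0)|; then an exponential with phi' = r phi, which does not
    contribute; then a multiple of cos (r (s - T)), for which phi'^2 - r^2 phi^2
    is negative on an arc of length pi/4 before T, where |u| >= |u(T)|, while the
    arc of length pi/2 after T, on which the negative part precedes the positive
    one, contributes at most 0.  The two arcs of length pi/4 cost the factor
    exp (pi/2) and the exponential yields exp (- r T).

    All of this is done on a time grid, where integrals are finite sums.  The
    implicit Euler quotient (v_n - v_{n-1}) / h - A v_n becomes, after a discrete
    Fourier transform, multiplication by (1 - q) / h - A with |q| = 1, and
    (1 - q) / h lies in the closed right half-plane: this is energy_inequality.
    Sampled cosines satisfy a second-difference equation exactly, so the energy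
    of the discrete cut-off telescopes (excess_telescope, decay_of_sum_bound).
    For u in the domain of A the Euler error is uniform in time
    (implicit_euler_error), and refining the grid gives decay_below, hence
    weighted_opnorm_le.

    Lower bound.  Equality is approached by the nilpotent shift on L^2(0, a):
    its norm is 1 for t < a and its resolvent is largest at 0, where it is the
    Volterra operator, of norm 2 a / pi, so that r a = pi / 2.  It is replaced
    here by a finite-dimensional model on C^d, the generator A = N - 1 with N the
    nilpotent shift matrix, whose semigroup is sum_k e^{-t} t^k / k! N^k.  The
    resolvent is controlled by a discrete Wirtinger inequality with sharp
    constant 2 sin (pi / (4 d + 2)) (volterra_bound, volterra_gap_le_rA0), and
    the norm at a time t slightly less than d is close to 1 because a
    Poisson variable of mean t has standard deviation sqrt t
    (poisson_tent, opnorm_shift_ge). *)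


(** * The optimal cut-off and its discrete energy balance *)

Section TestFunction.
Context {R : realType} (th : R).
Let x := 2 * sin (th / 2).

(** The discrete counterpart of phi'^2 - r^2 phi^2 for phi sampled from
    cos (y th); the chord x plays the role of r times the time step. *)
Definition excess (y : R) :=
  (cos ((y + 1) * th) - cos (y * th)) ^+ 2 - x ^+ 2 * cos (y * th) ^+ 2.
Definition excess_primitive (y : R) :=
  cos (y * th) * (cos (y * th) - cos ((y - 1) * th)).

Lemma cos_step : cos th = 1 - x ^+ 2 / 2.
Proof.
have -> : cos th = cos (th / 2 + th / 2) by congr cos; field.
have := cos2Dsin2 (th / 2); rewrite cosD /x.
set c := cos _; set s := sin _ => e.
have -> : c * c = 1 - s ^+ 2 by rewrite -e; ring.
by field.
Qed.

(** The chord x is chosen so that samples of the cosine satisfy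
    g (y + 1) - 2 g y + g (y - 1) = - x^2 g y, hence summation by parts leaves
    boundary terms only. *)
Lemma excess_telescope y :
  excess y = excess_primitive (y + 1) - excess_primitive y.
Proof.
rewrite /excess /excess_primitive addrK mulrBl !mulrDl !mul1r !(cosD, cosN, sinN).
have -> : x ^+ 2 = 2 - 2 * cos th by rewrite cos_step; field.
by ring.
Qed.

(** This product form shows the sign, which for small th is that of - cos (2 y th) up
    to the half-step shift coming from the forward difference. *)
Lemma excessE y : excess y = - (x ^+ 2 * cos (th / 2) * cos ((2 * y + 2^-1) * th)).
Proof.
rewrite /excess /x.
have -> : (y + 1) * th = (y * th + th / 2) + th / 2 by field.
have -> : (2 * y + 2^-1) * th = (y * th + th / 2) + y * th by field.
have e1 : cos (th / 2) ^+ 2 = 1 - sin (th / 2) ^+ 2 by rewrite -cos2sin2.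
have e2 : cos (y * th) ^+ 2 = 1 - sin (y * th) ^+ 2 by rewrite -cos2sin2.
rewrite !(cosD, sinD); move: e1 e2.
set a := cos (y * th); set b := sin (y * th).
set c := cos (th / 2); set s := sin (th / 2) => e1 e2.
have -> : (a * c - b * s) * c - (b * c + a * s) * s - a
    = - 2 * s * (b * c + a * s).
  have -> : (a * c - b * s) * c - (b * c + a * s) * s - a
    = a * c ^+ 2 - a - 2 * b * s * c - a * s ^+ 2 by ring.
  by rewrite e1; ring.
have -> : (- 2 * s * (b * c + a * s)) ^+ 2 - (2 * s) ^+ 2 * a ^+ 2
  = (2 * s) ^+ 2 * (b ^+ 2 * c ^+ 2 + 2 * a * b * c * s + a ^+ 2 * s ^+ 2 - a ^+ 2)
  by ring.
have -> : - ((2 * s) ^+ 2 * c * ((a * c - b * s) * a - (b * c + a * s) * b))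
  = (2 * s) ^+ 2 * (b ^+ 2 * c ^+ 2 + 2 * a * b * c * s - a ^+ 2 * c ^+ 2) by ring.
by rewrite e1; ring.
Qed.


Lemma excess_sum (m : nat) (y : R) :
  \sum_(i < m) excess (y + i%:R) = excess_primitive (y + m%:R) - excess_primitive y.
Proof.
elim: m => [|m IH]; first by rewrite big_ord0 addr0 subrr.
by rewrite big_ord_recr /= IH excess_telescope -natr1 (addrA y); ring.
Qed.

(* K steps fill an arc of length pi / 4; J is the number of steps of exponential
   growth. *)
Context (K J : nat) (K_gt0 : (0 < K)%N) (th_def : th * K%:R = pi / 4).

Lemma angle_gt0 : 0 < th.
Proof.
have K0 : 0 < K%:R :> R by rewrite ltr0n.
by rewrite -(pmulr_lgt0 _ K0) th_def divr_gt0 ?pi_gt0.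
Qed.

Lemma angle_le : th <= pi / 4.
Proof.
by rewrite -th_def ler_peMr ?ler1n // ltW ?angle_gt0.
Qed.

Lemma cos_half_angle_gt0 : 0 < cos (th / 2).
Proof.
apply: cos_gt0_pihalf; have := angle_gt0; have := angle_le; have := @pi_gt0 R; lra.
Qed.

Lemma chord_gt0 : 0 < x.
Proof.
rewrite mulr_gt0 //; apply: sin_gt0_pihalf.
have := angle_gt0; have := angle_le; have := @pi_gt0 R; lra.
Qed.

Lemma excess_coef_ge0 : 0 <= x ^+ 2 * cos (th / 2).
Proof. by rewrite mulr_ge0 ?sqr_ge0 // ltW // cos_half_angle_gt0. Qed.

Lemma angle_range (n : nat) : (n < K)%N ->
  0 <= (2 * n%:R + 2^-1) * th <= pi / 2.
Proof.
move=> nK; have th0 := angle_gt0.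
rewrite mulr_ge0 ?addr_ge0 ?mulr_ge0 ?invr_ge0 ?ler0n ?(ltW th0) //=.
have : n%:R + 1 <= K%:R :> R by rewrite natr1 ler_nat.
have -> : pi / 2 = (2 * K%:R) * th by rewrite -mulrA (mulrC K%:R) th_def; field.
by move=> h; rewrite ler_pM2r //; lra.
Qed.

Lemma excess_start_ge0 n : (n < K)%N -> 0 <= excess (n%:R - 2 * K%:R).
Proof.
move=> nK; rewrite excessE.
have -> : (2 * (n%:R - 2 * K%:R) + 2^-1) * th = (2 * n%:R + 2^-1) * th - pi.
  have -> : pi = 4 * (th * K%:R) by rewrite th_def; field.
  by ring.
rewrite cosB cospi sinpi mulr0 addr0 mulrN1 mulrN opprK.
apply: mulr_ge0; first exact: excess_coef_ge0.
by apply: cos_ge0_pihalf; have := angle_range nK; have := @pi_gt0 R; lra.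
Qed.

Lemma excess_before_le0 n : (n < K)%N -> excess (n%:R - K%:R) <= 0.
Proof.
move=> nK; rewrite excessE oppr_le0.
have -> : (2 * (n%:R - K%:R) + 2^-1) * th = (2 * n%:R + 2^-1) * th - pi / 2.
  have -> : pi / 2 = 2 * (th * K%:R) by rewrite th_def; field.
  by ring.
apply: mulr_ge0; first exact: excess_coef_ge0.
by apply: cos_ge0_pihalf; have := angle_range nK; have := @pi_gt0 R; lra.
Qed.

Lemma excess_after_le0 n : (n < K)%N -> excess n%:R <= 0.
Proof.
move=> nK; rewrite excessE oppr_le0.
apply: mulr_ge0; first exact: excess_coef_ge0.
by apply: cos_ge0_pihalf; have := angle_range nK; have := @pi_gt0 R; lra.
Qed.

Lemma excess_end_ge0 n : (n < K)%N -> 0 <= excess (K%:R + n%:R).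
Proof.
move=> nK; rewrite excessE.
have -> : (2 * (K%:R + n%:R) + 2^-1) * th = (2 * n%:R + 2^-1) * th + pi / 2.
  have -> : pi / 2 = 2 * (th * K%:R) by rewrite th_def; field.
  by ring.
rewrite cosDpihalf mulrN opprK.
apply: mulr_ge0; first exact: excess_coef_ge0.
by apply: sin_ge0_pi; have := angle_range nK; have := @pi_gt0 R; lra.
Qed.

Let C := (1 + x) ^+ J.

(** The rising branch is the sine arc, written as a cosine shifted by a quarter
    period, that is by 2 K steps.  The switch to geometric growth happens at the
    arc pi / 4, where sine and cosine agree, so that on a fine mesh the increment
    is about x times the value; the falling branch starts at the corresponding
    point of the cosine.  The maximum is reached at K + J + K and the value 0 at
    K + J + 3 K, where the sums stop. *)
Definition cutoff (n : nat) : R :=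
  if (n <= K)%N then cos ((n%:R - 2 * K%:R) * th)
  else if (n <= K + J)%N then cos (K%:R * th) * (1 + x) ^+ (n - K)
  else (1 + x) ^+ J * cos ((n%:R - (J + 2 * K)%:R) * th).

Lemma cutoff_rise n : (n <= K)%N -> cutoff n = cos ((n%:R - 2 * K%:R) * th).
Proof. by rewrite /cutoff => ->. Qed.

Lemma cutoff_growth j : (j <= J)%N -> cutoff (K + j) = cos (K%:R * th) * (1 + x) ^+ j.
Proof.
move=> jJ; rewrite /cutoff -[X in (_ <= X)%N]addn0 !leq_add2l jJ addKn.
case: j jJ => [|j] // _; rewrite addn0 expr0 mulr1 -[RHS]cosN.
by congr cos; ring.
Qed.

Lemma cutoff_fall i : cutoff (K + J + i) = C * cos ((i%:R - K%:R) * th).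
Proof.
case: i => [|i].
  by rewrite addn0 cutoff_growth // sub0r mulNr cosN mulrC.
rewrite /cutoff.
rewrite (_ : (K + J + i.+1 <= K)%N = false); last first.
  by apply/negbTE; rewrite -ltnNge; rewrite -addnA -[X in (X < _)%N]addn0 ltn_add2l addnS.
rewrite (_ : (K + J + i.+1 <= K + J)%N = false); last first.
  by apply/negbTE; rewrite -ltnNge -[X in (X < _)%N]addn0 ltn_add2l.
by congr (_ * cos (_ * _)); 
  rewrite (natrD _ J) natrM (natrD _ (K + J) i.+1) (natrD _ K J); ring.
Qed.


Lemma cutoff0 : cutoff 0 = 0.
Proof.
rewrite cutoff_rise // sub0r mulNr cosN -(@cos_pihalf R).
by congr cos; rewrite -mulrA (mulrC K%:R) th_def; field.
Qed.

Lemma cutoff_end : cutoff (K + J + (K + (K + K))) = 0.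
Proof.
rewrite cutoff_fall.
have -> : (K + (K + K))%:R - K%:R = 2 * K%:R :> R.
  by rewrite natrD (natrD _ K K); ring.
have -> : 2 * K%:R * th = pi / 2 by rewrite -mulrA (mulrC K%:R) th_def; field.
by rewrite cos_pihalf mulr0.
Qed.

Lemma growth_ge1 j : 1 <= (1 + x) ^+ j.
Proof. by rewrite exprn_ege1 // lerDl ltW // chord_gt0. Qed.

Lemma sqr_cos_le1 (a : R) : cos a ^+ 2 <= 1.
Proof. by rewrite cos2sin2 lerBlDr lerDl sqr_ge0. Qed.

Lemma cutoff_le n : cutoff n ^+ 2 <= C ^+ 2.
Proof.
rewrite /cutoff; case: ifP => _; last case: ifP => nKJ.
- by rewrite (le_trans (sqr_cos_le1 _)) // exprn_ege1 // growth_ge1.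
- rewrite exprMn -[leRHS]mul1r ler_pM ?sqr_ge0 ?sqr_cos_le1 //.
  rewrite ler_sqr ?nnegrE ?(le_trans ler01) ?growth_ge1 //.
  by rewrite ler_weXn2l ?lerDl ?(ltW chord_gt0) // leq_subLR.
- by rewrite exprMn -[leRHS]mulr1 ler_pM ?sqr_ge0 ?sqr_cos_le1.
Qed.

Definition cutoff_excess n := (cutoff n.+1 - cutoff n) ^+ 2 - x ^+ 2 * cutoff n ^+ 2.

Lemma cutoff_excess_rise n : (n < K)%N -> cutoff_excess n = excess (n%:R - 2 * K%:R).
Proof.
move=> nK; rewrite /cutoff_excess !cutoff_rise ?(ltnW nK) //.
by rewrite /excess -natr1 addrAC.
Qed.

(** With ratio 1 + x the increment is exactly x times the value. *)
Lemma cutoff_excess_growth j : (j < J)%N -> cutoff_excess (K + j) = 0.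
Proof.
move=> jJ; rewrite /cutoff_excess -addnS !cutoff_growth ?(ltnW jJ) // (exprS _ j).
by ring.
Qed.

Lemma cutoff_excess_fall i : cutoff_excess (K + J + i) = C ^+ 2 * excess (i%:R - K%:R).
Proof.
by rewrite /cutoff_excess -addnS !cutoff_fall /excess -natr1 (addrAC i%:R); ring.
Qed.

Let s1 := excess_primitive (- K%:R).

Lemma excess_primitive_pihalf (y : R) : y * th = pi / 2 \/ y * th = - (pi / 2) ->
  excess_primitive y = 0.
Proof.
by move=> [] e; rewrite /excess_primitive e ?cosN cos_pihalf mul0r.
Qed.

Lemma two_K : 2 * K%:R * th = pi / 2.
Proof. by rewrite -mulrA (mulrC K%:R) th_def; field. Qed.

Lemma excess_primitive0 : excess_primitive 0 = x ^+ 2 / 2.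
Proof.
by rewrite /excess_primitive mul0r cos0 sub0r mulN1r cosN cos_step; ring.
Qed.

(** The energy of an arc of length pi / 4 is of first order in the chord, so it
    dominates boundary terms of order x^2. *)
Lemma start_sum_ge : x / 2 <= s1.
Proof.
have th0 := angle_gt0; have th1 := angle_le.
have p0 := @pi_gt0 R.
rewrite /s1 /excess_primitive.
have -> : (- K%:R - 1) * th = - ((pi / 4 + th / 2) + th / 2).
  by rewrite -th_def; field.
have -> : - K%:R * th = - (pi / 4) by rewrite -th_def; ring.
rewrite !cosN.
have -> : cos (pi / 4) - cos ((pi / 4 + th / 2) + th / 2)
   = x * sin (pi / 4 + th / 2).
  have cosBD a b : cos (a - b) - cos (a + b) = 2 * sin b * sin a :> R.
    by rewrite cosB cosD; ring.
  by rewrite -cosBD addrK.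
rewrite mulrCA ler_pM2l ?chord_gt0 //.
have q0 : 0 < cos (pi / 4 : R) by apply: cos_gt0_pihalf; lra.
have e : cos (pi / 4) = sin (pi / 4) :> R.
  by rewrite -cosBpihalf -cosN; congr cos; field.
have e2 : 2^-1 = cos (pi / 4) * sin (pi / 4) :> R.
  have := cos2Dsin2 (pi / 4 : R); rewrite -!e => h.
  by lra.
rewrite [leLHS]e2 ler_pM2l //.
apply: ltW; rewrite ltr_sin; last 2 first.
- by rewrite in_itv /=; apply/andP; split; lra.
- by rewrite in_itv /=; apply/andP; split; lra.
lra.
Qed.

(** A decreasing weight N is compared with a constant on each branch: N 0 on the
    rising one, the value at the maximum before the maximum, and the value a
    further arc pi / 4 later after it. *)
Lemma weighted_cutoff_excess (N : nat -> R) :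
  (forall n, 0 <= N n) -> (forall m n, (m <= n)%N -> N n <= N m) ->
  \sum_(n < K + J + (K + (K + K))) cutoff_excess n * N n <=
  s1 * N 0 - C ^+ 2 * (s1 - x ^+ 2 / 2) * N (K + J + K).
Proof.
move=> N0 Nmono.
rewrite !big_split_ord /=.
have h1 : \sum_(i < K) cutoff_excess i * N i <= s1 * N 0.
  have -> : s1 = \sum_(i < K) excess (- 2 * K%:R + i%:R).
    rewrite excess_sum (@excess_primitive_pihalf (- 2 * _)) ?subr0.
      by congr excess_primitive; ring.
    by right; rewrite !mulNr two_K.
  rewrite mulr_suml; apply: ler_sum => i _.
  rewrite cutoff_excess_rise // mulNr [in leRHS]addrC ler_wpM2l ?excess_start_ge0 //.
  exact: Nmono.
have -> : \sum_(i < J) cutoff_excess (K + i) * N (K + i) = 0.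
  by apply: big1 => i _; rewrite cutoff_excess_growth ?mul0r.
have h3 : \sum_(i < K) cutoff_excess (K + J + i) * N (K + J + i)
   <= C ^+ 2 * (x ^+ 2 / 2 - s1) * N (K + J + K).
  have -> : x ^+ 2 / 2 - s1 = \sum_(i < K) excess (- K%:R + i%:R).
    by rewrite excess_sum addNr excess_primitive0.
  rewrite mulr_sumr mulr_suml; apply: ler_sum => i _.
  rewrite cutoff_excess_fall (addrC (- _)) -!(mulrA (C ^+ 2)) ler_wpM2l ?sqr_ge0 //.
  rewrite ler_wnM2l ?excess_before_le0 //.
  by apply: Nmono; rewrite leq_add2l ltnW.
have h4 : \sum_(i < K) cutoff_excess (K + J + (K + i)) * N (K + J + (K + i))
   <= \sum_(i < K) C ^+ 2 * excess i%:R * N (K + J + (K + K)).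
  apply: ler_sum => i _.
  rewrite cutoff_excess_fall natrD addrAC subrr add0r -!(mulrA (C ^+ 2)) ler_wpM2l ?sqr_ge0 //.
  rewrite ler_wnM2l ?excess_after_le0 //.
  by apply: Nmono; rewrite !leq_add2l ltnW.
have h5 : \sum_(i < K) cutoff_excess (K + J + (K + (K + i))) * N (K + J + (K + (K + i)))
   <= \sum_(i < K) C ^+ 2 * excess (K%:R + i%:R) * N (K + J + (K + K)).
  apply: ler_sum => i _.
  rewrite cutoff_excess_fall natrD addrAC subrr add0r natrD -!(mulrA (C ^+ 2)) ler_wpM2l ?sqr_ge0 //.
  rewrite ler_wpM2l ?excess_end_ge0 //.
  by apply: Nmono; rewrite !leq_add2l leq_addr.
(* From the maximum to the end the total energy is a boundary term of the
   right sign. *)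
have h45 : \sum_(i < K) C ^+ 2 * excess i%:R * N (K + J + (K + K)) +
   \sum_(i < K) C ^+ 2 * excess (K%:R + i%:R) * N (K + J + (K + K)) <= 0.
  rewrite -!mulr_suml -mulrDl -!mulr_sumr -mulrDr.
  have -> : \sum_(i < K) excess i%:R = \sum_(i < K) excess (0 + i%:R).
    by apply: eq_bigr => i _; rewrite add0r.
  rewrite !excess_sum add0r addrC addrA subrK.
  rewrite (@excess_primitive_pihalf (_ + _)).
    rewrite sub0r excess_primitive0 mulrN mulNr oppr_le0.
    apply: mulr_ge0 => //; apply: mulr_ge0; first exact: sqr_ge0.
    by rewrite divr_ge0 ?sqr_ge0.
  by left; rewrite -two_K; ring.
have -> : C ^+ 2 * (s1 - x ^+ 2 / 2) * N (K + J + K)%N =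
   - (C ^+ 2 * (x ^+ 2 / 2 - s1) * N (K + J + K)%N) by ring.
move: h1 h3 h4 h5 h45; lra.
Qed.

(** The energy inequality for the cut-off, in the abstract: N n stands for the
    squared norm of the solution at time step n and e for the squared
    discretisation error. *)
Lemma decay_of_sum_bound (N : nat -> R) (e : R) : 0 <= e -> 
  (forall n, 0 <= N n) -> (forall m n, (m <= n)%N -> N n <= N m) ->
  x ^+ 2 * \sum_(n < K + J + (K + (K + K))) cutoff n ^+ 2 * N n <=
  \sum_(n < K + J + (K + (K + K))) (cutoff n.+1 - cutoff n) ^+ 2 * N n +
   e * \sum_(n < K + J + (K + (K + K))) cutoff n ^+ 2 ->
  C ^+ 2 * (1 - x) * N (K + J + K) <= N 0 + 2 * e * (4 * K + J)%:R * C ^+ 2 / x.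
Proof.
move=> e0 N0 Nmono h.
have x0 := chord_gt0; have hs := start_sum_ge.
have s10 : 0 < s1 by lra.
have hc : e * \sum_(n < K + J + (K + (K + K))) cutoff n ^+ 2 <= 
          e * (4 * K + J)%:R * C ^+ 2.
  rewrite -mulrA ler_wpM2l //.
  have -> : (4 * K + J)%:R * C ^+ 2 = \sum_(n < K + J + (K + (K + K))) C ^+ 2.
    by rewrite sumr_const card_ord mulr_natl; congr (_ *+ _); ring.
  by apply: ler_sum => i _; exact: cutoff_le.
have h1 : 0 <= \sum_(n < K + J + (K + (K + K))) cutoff_excess n * N n + 
           e * (4 * K + J)%:R * C ^+ 2.
  rewrite (eq_bigr (fun n : 'I__ => (cutoff n.+1 - cutoff n) ^+ 2 * N n - 
     x ^+ 2 * (cutoff n ^+ 2 * N n))); last first.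
    by move=> i _; rewrite /cutoff_excess mulrBl mulrA.
  rewrite big_split /= sumrN -mulr_sumr; lra.
have h2 := weighted_cutoff_excess N0 Nmono.
set E := e * _ * _ in h1 hc.
have E0 : 0 <= E.
  by apply: mulr_ge0; [exact: mulr_ge0|exact: sqr_ge0].
have h3 : C ^+ 2 * (s1 - x ^+ 2 / 2) * N (K + J + K)%N <= s1 * N 0 + E by lra.
have -> : 2 * e * (4 * K + J)%:R * C ^+ 2 / x = E / (x / 2).
  by rewrite /E; field; rewrite gt_eqF.
apply: (@le_trans _ _ (N 0 + E / s1)); last first.
  by rewrite lerD2l ler_wpM2l // lef_pV2 ?posrE //; lra.
rewrite -(@ler_pM2l _ s1) // (_ : s1 * (N 0 + E / s1) = s1 * N 0 + E); last first.
  by field; rewrite gt_eqF.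
apply: le_trans h3.
have -> : s1 * (C ^+ 2 * (1 - x) * N (K + J + K)%N)
   = C ^+ 2 * (s1 - s1 * x) * N (K + J + K)%N by ring.
apply: ler_wpM2r => //; apply: ler_wpM2l; first exact: sqr_ge0.
by rewrite lerB // expr2 mulrAC ler_pM2r.
Qed.

End TestFunction.

(** * Meshes refining to zero *)

(** Mean value theorem for the sine. *)
Lemma sin_bounds {R : realType} (y : R) : 0 <= y <= pi / 2 -> y * cos y <= sin y <= y.
Proof.
move=> /andP[y0 y1].
have [|c] := MVT_segment y0 (fun z _ => is_derive_sin z).
  by apply: continuous_subspaceT => z; exact: continuous_sin.
rewrite in_itv /= => /andP[c0 cy]; rewrite sin0 !subr0 => ->.
rewrite ler_piMl ?cos_le1 // andbT mulrC ler_wpM2r //.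
have [->//|yc] := eqVneq c y.
have ltcy : c < y by rewrite lt_neqAle yc.
have pi0 := @pi_gt0 R.
have cpi : c \in `[0, pi] by rewrite in_itv /= c0 /=; lra.
have ypi : y \in `[0, pi] by rewrite in_itv /= y0 /=; lra.
by rewrite ltW // ltr_cos.
Qed.

Section Mesh.
Context {R : realType}.

(** The chord of one of the n + 1 equal parts of an arc of length pi / 4. *)
Definition mesh (n : nat) : R := 2 * sin (pi / 4 / n.+1%:R / 2).

Lemma mesh_gt0 n : 0 < mesh n.
Proof. by apply: (@chord_gt0 R _ n.+1); rewrite // divfK // pnatr_eq0. Qed.

Lemma mesh_le n : mesh n <= pi / 4 / n.+1%:R.
Proof.
rewrite /mesh; set th : R := _ / n.+1%:R.
have thK : th * n.+1%:R = pi / 4 by rewrite divfK // pnatr_eq0.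
have := angle_le (ltn0Sn n) thK; have := angle_gt0 (ltn0Sn n) thK.
have := @pi_gt0 R => p0 t0 t1.
have y0 : 0 <= th / 2 <= pi / 2 by apply/andP; split; lra.
by have /andP[_ h] := sin_bounds y0; lra.
Qed.

Lemma cvg_mesh : mesh @ \oo --> (0 : R).
Proof.
apply: (@squeeze_cvgr _ _ _ _ (fun=> 0) (fun n => pi / 4 * harmonic n)).
- by apply: nearW => n; rewrite ltW ?mesh_gt0 //= mesh_le.
- exact: cvg_cst.
- by rewrite -[X in _ --> X](mulr0 (pi / 4)); apply: cvgMr; exact: cvg_harmonic.
Qed.

(** Geometric growth loses only a factor 1 + x in the exponent compared with the
    exponential. *)
Lemma expR_le_growth (x : R) J : 0 <= x -> expR (J%:R * x / (1 + x)) <= (1 + x) ^+ J.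
Proof.
move=> x0; have x1 : 0 < 1 + x by lra.
rewrite -mulrA expRM_natl; apply: lerXn2r; rewrite ?nnegrE ?expR_ge0 ?(ltW x1) //.
rewrite -[leRHS]invrK -[leLHS]invrK -expRN lef_pV2 ?posrE ?invr_gt0 ?expR_gt0 //.
apply: le_trans (expR_ge1Dx _).
by rewrite (_ : 1 + - (x / (1 + x)) = (1 + x)^-1) //; field; rewrite gt_eqF.
Qed.

End Mesh.


(** * Discrete Fourier transform in a Hilbert space *)

(** The polynomial X^n - 1 splits and has distinct roots. *)
Lemma closed_prim_root_exists (F : numClosedFieldType) n : (0 < n)%N ->
  exists w : F, n.-primitive_root w.
Proof.
move=> n0; have [r] := closed_field_poly_normal ('X^n - 1 : {poly F}).
rewrite (monicP _) ?monicXnsubC // scale1r => Dp.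
have hr : all n.-unity_root r by apply/allP=> z; rewrite -root_prod_XsubC -Dp.
have ur : uniq r by rewrite -separable_prod_XsubC -Dp separable_Xn_sub_1 // pnatr_eq0 -lt0n.
have sr : (n <= size r)%N by rewrite -ltnS -(size_prod_XsubC r id) -Dp size_XnsubC.
by have /hasP[w _ hw] := cyclic.has_prim_root n0 hr ur sr; exists w.
Qed.

Section Parseval.
Context {C : numClosedFieldType} {V : lmodType C} (dot : {dot V for Num.conj}).
Context (P : nat) (w : C) (w_prim : P.-primitive_root w).

Definition dft (v : nat -> V) (k : nat) := \sum_(n < P) (w ^+ k) ^+ n *: v n.

Lemma norm_prim_root : `|w| = 1.
Proof.
apply/eqP; rewrite -(@pexpr_eq1 _ _ P) ?(prim_order_gt0 w_prim) //.
by rewrite -normrX (prim_expr_order w_prim) normr1.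
Qed.

Lemma conj_prim_root : w^* = w^-1.
Proof. by rewrite invC_norm norm_prim_root expr1n invr1 mul1r. Qed.

(** Orthogonality of the characters of the cyclic group of order P. *)
Lemma character_sum (m n : 'I_P) :
  \sum_(k < P) (w ^+ k) ^+ m * ((w ^+ k) ^+ n)^* = (P * (m == n))%:R.
Proof.
have w0 : w != 0 by rewrite -normr_eq0 norm_prim_root oner_eq0.
rewrite (eq_bigr (fun k : 'I_P => (w ^+ m / w ^+ n) ^+ k)); last first.
  move=> k _; rewrite !rmorphXn /= conj_prim_root expr_div_n !exprVn.
  by rewrite -!exprM mulnC [(n * k)%N]mulnC.
have [->|mn] := eqVneq.
  rewrite divff ?expf_neq0 // (eq_bigr (fun=> 1)) => [|k _]; last by rewrite expr1n.
  by rewrite sumr_const card_ord muln1.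
rewrite muln0; apply: (@mulfI _ (w ^+ m / w ^+ n - 1)).
  rewrite subr_eq0 -(inj_eq (mulIf (expf_neq0 n w0))) mul1r divfK ?expf_neq0 //.
  by rewrite (eq_prim_root_expr w_prim) !modn_small.
by rewrite -subrX1 mulr0 expr_div_n -!exprM mulnC [(n * P)%N]mulnC !exprM
  (prim_expr_order w_prim) !expr1n divr1 subrr.
Qed.

Lemma parseval (v : nat -> V) :
  \sum_(k < P) dot (dft v k) (dft v k) = P%:R * \sum_(n < P) dot (v n) (v n).
Proof.
rewrite (eq_bigr (fun k : 'I_P => \sum_(m < P) \sum_(n < P)
   ((w ^+ k) ^+ m * ((w ^+ k) ^+ n)^* * dot (v m) (v n)))); last first.
  move=> k _; rewrite /dft linear_sumlz; apply: eq_bigr => m _ /=.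
  rewrite linear_sumr; apply: eq_bigr => n _.
  by rewrite linearZl_LR linearZr_LR /= mulrA.
rewrite exchange_big /= mulr_sumr; apply: eq_bigr => m _.
rewrite exchange_big /=.
under eq_bigr do rewrite -mulr_suml character_sum.
rewrite (bigD1 m) //= eqxx muln1 big1 ?addr0 // => n nm.
by rewrite eq_sym (negbTE nm) muln0 mul0r.
Qed.

End Parseval.


(** * Real-valued norms *)

Section RealNorm.
Context {R : realType} {H : completeNormedModType R[i]}.
Implicit Types u v : H.

(** The norm as a real number, so that real inequalities can be used. *)
Definition nrm u : R := complex.Re `|u|.

Lemma nrmE u : `|u| = (nrm u)%:C.
Proof. by rewrite /nrm RRe_real // ger0_real. Qed.

Lemma nrm_ge0 u : 0 <= nrm u.
Proof. by rewrite -ler0c -nrmE. Qed.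

Lemma nrmD u v : nrm (u + v) <= nrm u + nrm v.
Proof. by rewrite -lecR rmorphD /= -!nrmE ler_normD. Qed.

Lemma nrmN u : nrm (- u) = nrm u.
Proof. by rewrite /nrm normrN. Qed.

Lemma nrmB u v : nrm (u - v) = nrm (v - u).
Proof. by rewrite -nrmN opprB. Qed.

Lemma nrm0 : nrm 0 = 0.
Proof. by rewrite /nrm normr0. Qed.

Lemma nrm_eq0 u : (nrm u == 0) = (u == 0).
Proof. by rewrite -(inj_eq (@complexI R)) -nrmE normr_eq0. Qed.

Lemma nrmZ (a : R[i]) u : nrm (a *: u) = complex.Re `|a| * nrm u.
Proof.
apply: (@complexI R); rewrite rmorphM -[LHS]nrmE normrZ -[X in _ = _ * X]nrmE.
by congr (_ * _); rewrite [RHS]RRe_real ?ger0_real.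
Qed.

Lemma nrmZr (a : R) u : nrm (a%:C *: u) = `|a| * nrm u.
Proof.
by rewrite nrmZ normc_def /= expr0n addr0 sqrtr_sqr.
Qed.

Lemma nrm_sum (K : nat) (f : nat -> H) :
  nrm (\sum_(k < K) f k) <= \sum_(k < K) nrm (f k).
Proof.
elim: K => [|K IH]; first by rewrite !big_ord0 nrm0.
by rewrite !big_ord_recr /=; apply: le_trans (nrmD _ _) _; rewrite lerD2r.
Qed.

(** Young's inequality. *)
Lemma nrmD_sqr (d : R) u v : 0 < d ->
  nrm (u + v) ^+ 2 <= (1 + d) * nrm u ^+ 2 + (1 + d^-1) * nrm v ^+ 2.
Proof.
move=> d0; apply: (@le_trans _ _ ((nrm u + nrm v) ^+ 2)).
  by rewrite ler_sqr ?nnegrE ?addr_ge0 ?nrm_ge0 // nrmD.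
rewrite -subr_ge0.
have -> : (1 + d) * nrm u ^+ 2 + (1 + d^-1) * nrm v ^+ 2 - (nrm u + nrm v) ^+ 2
  = d^-1 * (d * nrm u - nrm v) ^+ 2 by field; rewrite gt_eqF.
by rewrite mulr_ge0 ?invr_ge0 ?sqr_ge0 // ltW.
Qed.

Lemma nrm_sqr_le u v : (nrm u ^+ 2 <= nrm v ^+ 2) = (nrm u <= nrm v).
Proof. by rewrite ler_sqr ?nnegrE ?nrm_ge0. Qed.

Lemma nrm_scaled_le (c : R) u v : 0 <= c ->
  c ^+ 2 * nrm u ^+ 2 <= nrm v ^+ 2 -> c * nrm u <= nrm v.
Proof. by move=> c0; rewrite -exprMn ler_sqr ?nnegrE ?mulr_ge0 ?nrm_ge0. Qed.

(** Twice the real part of the product of v and u is at most |u|^2 + |v|^2, because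
    |u - v|^2 is nonnegative. *)
Lemma contraction_accretive (dot : {dot H for Num.conj}) u v :
  hilbert_product dot -> nrm v <= nrm u -> 0 <= complex.Re (dot (u - v) u).
Proof.
move=> hdot hvu; set w := dot v u.
have -> : complex.Re (dot (u - v) u) = nrm u ^+ 2 - complex.Re w.
  by rewrite linearBl raddfB /= hdot nrmE -rmorphXn.
have e2 : nrm (u - v) ^+ 2 = nrm u ^+ 2 + nrm v ^+ 2 - 2 * complex.Re w.
  apply: (@complexI R); rewrite [LHS]rmorphXn /= -nrmE -hdot.
  rewrite dnormB !hdot !nrmE hermC expr0 mul1r -/w conjCK.
  rewrite rmorphB rmorphD !rmorphXn rmorphM; congr (_ - _).
  by rewrite addrC [X in _ = _ * X]complexRe ReE rmorph_nat mulrC divfK ?pnatr_eq0.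
have := sqr_ge0 (nrm (u - v)); move: hvu; rewrite -nrm_sqr_le e2; lra.
Qed.

Lemma parseval_nrm (dot : {dot H for Num.conj}) (P : nat) (w : R[i]) (v : nat -> H) :
  hilbert_product dot -> P.-primitive_root w ->
  \sum_(k < P) nrm (dft P w v k) ^+ 2 = P%:R * \sum_(n < P) nrm (v n) ^+ 2.
Proof.
move=> hdot hw; apply: (@complexI R).
rewrite rmorphM /= !rmorph_sum rmorph_nat /=.
transitivity (\sum_(k < P) dot (dft P w v k) (dft P w v k)).
  by apply: eq_bigr => k _; rewrite rmorphXn /= -nrmE hdot.
rewrite parseval //; congr (_ * _).
by apply: eq_bigr => k _; rewrite rmorphXn /= -nrmE hdot.
Qed.

End RealNorm.


(** * Energy inequality for an operator with bounded resolvent *)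

Section Operator.
Context {R : realType} {H : completeNormedModType R[i]} (A : operator H).
Implicit Types u v : H.

Lemma opfun0 : A 0 = 0.
Proof.
have := opfun_linear 1 (opdom0 A) (opdom0 A).
by rewrite scaler0 addr0 scale1r => /eqP; rewrite -subr_eq subrr => /eqP.
Qed.

Lemma opdomZ (a : R[i]) u : opdom A u -> opdom A (a *: u).
Proof. by move=> hu; rewrite -[_ *: _]addr0; apply: opdom_linear (opdom0 A). Qed.

Lemma opfunZ (a : R[i]) u : opdom A u -> A (a *: u) = a *: A u.
Proof.
move=> hu; rewrite -[in LHS](addr0 (a *: u)) opfun_linear ?opfun0 ?addr0 //.
exact: opdom0.
Qed.

Lemma opdomB u v : opdom A u -> opdom A v -> opdom A (u - v).
Proof. by move=> hu hv; rewrite addrC -scaleN1r; exact: opdom_linear. Qed.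

Lemma opfunB u v : opdom A u -> opdom A v -> A (u - v) = A u - A v.
Proof.
by move=> hu hv; rewrite addrC -scaleN1r opfun_linear // scaleN1r addrC.
Qed.

Lemma opdom_sum (a : nat -> R[i]) (v : nat -> H) n :
  (forall i, opdom A (v i)) -> opdom A (\sum_(i < n) a i *: v i).
Proof.
move=> hv; elim: n => [|n IH]; first by rewrite big_ord0; exact: opdom0.
by rewrite big_ord_recr /= addrC; apply: opdom_linear.
Qed.

Lemma opfun_sum (a : nat -> R[i]) (v : nat -> H) n :
  (forall i, opdom A (v i)) -> A (\sum_(i < n) a i *: v i) = \sum_(i < n) a i *: A (v i).
Proof.
move=> hv; elim: n => [|n IH]; first by rewrite !big_ord0 opfun0.
rewrite !big_ord_recr /= addrC opfun_linear ?IH //; first by rewrite addrC.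
exact: opdom_sum.
Qed.

Context (r : R).
Hypothesis resolvent_bound : forall z : R[i], 0 < complex.Re z ->
  forall u, opdom A u -> r * nrm u <= nrm (z *: u - A u).

(** The bound passes to the imaginary axis by moving z slightly to the right;
    this is needed at z = 0, which comes from the constant Fourier mode. *)
Lemma closed_half_plane_bound (z : R[i]) u : 0 <= complex.Re z ->
  opdom A u -> r * nrm u <= nrm (z *: u - A u).
Proof.
move=> z0 hu; apply/ler_addgt0Pr => e e0.
have u1 : 0 < nrm u + 1 by rewrite ltr_wpDl ?nrm_ge0.
pose d := e / (nrm u + 1).
have d0 : 0 < d by rewrite divr_gt0.
have zd : 0 < complex.Re (z + d%:C) by rewrite raddfD /= ltr_wpDl.
apply: le_trans (resolvent_bound zd hu) _.
rewrite scalerDl addrAC; apply: le_trans (nrmD _ _) _.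
rewrite lerD2l nrmZr (ger0_norm (ltW d0)) /d mulrAC ler_pdivrMr //.
by rewrite ler_wpM2l ?lerDl // ltW.
Qed.

(** The point (1 - q) / h is in the closed right half-plane: this is what makes
    the implicit Euler scheme compatible with the resolvent bound. *)
Lemma unit_circle_bound (q : R[i]) (h : R) u : 0 < h -> `|q| = 1 -> opdom A u ->
  h * r * nrm u <= nrm ((1 - q) *: u - h%:C *: A u).
Proof.
move=> h0 q1 hu.
have hC : h%:C != 0 by rewrite (inj_eq (@complexI R)) gt_eqF.
have -> : (1 - q) *: u - h%:C *: A u = h%:C *: ((h^-1%:C * (1 - q)) *: u - A u).
  by rewrite scalerBr scalerA mulrA -rmorphM /= divff ?gt_eqF // mul1r.
rewrite nrmZr (gtr0_norm h0) -mulrA ler_pM2l //.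
apply: closed_half_plane_bound => //.
have -> : complex.Re (h^-1%:C * (1 - q)) = h^-1 * (1 - complex.Re q).
  by case: q {q1} => a b /=; ring.
rewrite mulr_ge0 ?invr_ge0 ?(ltW h0) // subr_ge0.
by apply: le_trans (ler_norm _) _; rewrite -lecR rmorph1 -q1 normc_ge_Re.
Qed.

(** Plancherel for sequences that vanish at both ends, so that they may be
    regarded as periodic: the Fourier transform of the implicit Euler defect is,
    up to a unimodular factor, (1 - q - h A) applied to the transform of v. *)
Lemma energy_inequality (dot : {dot H for Num.conj}) (P : nat) (v : nat -> H) (h : R) :
  hilbert_product dot -> (0 < P)%N -> 0 < h -> 0 <= r ->
  (forall n, opdom A (v n)) -> v 0 = 0 -> v P = 0 ->
  (h * r) ^+ 2 * \sum_(n < P) nrm (v n) ^+ 2 <=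
  \sum_(n < P) nrm (v n.+1 - v n - h%:C *: A (v n.+1)) ^+ 2.
Proof.
move=> hdot P0 h0 r0 hv v0 vP.
have [w hw] := @closed_prim_root_exists R[i] P P0.
rewrite -(@ler_pM2l _ P%:R) ?ltr0n // mulrCA.
pose f n := v n.+1 - v n - h%:C *: A (v n.+1).
rewrite -(parseval_nrm v hdot hw) -(parseval_nrm f hdot hw) mulr_sumr.
apply: ler_sum => k _; rewrite -exprMn ler_sqr ?nnegrE ?mulr_ge0 ?nrm_ge0 ?(ltW h0) //.
set q := w ^+ k; pose Y := \sum_(n < P) q ^+ n *: v n.+1.
have q1 : `|q| = 1 by rewrite normrX (norm_prim_root hw) expr1n.
(* Y is the transform of the shifted sequence. *)
have qY : q *: Y = dft P w v k.
  transitivity (\sum_(n < P.+1) q ^+ n *: v n).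
    rewrite big_ord_recl /= v0 scaler0 add0r scaler_sumr.
    by apply: eq_bigr => n _; rewrite scalerA -exprS.
  by rewrite big_ord_recr /= vP scaler0 addr0.
have -> : nrm (dft P w f k) = nrm (q *: dft P w f k).
  by rewrite nrmZ q1 /= mul1r.
have -> : q *: dft P w f k = (1 - q) *: dft P w v k - h%:C *: A (dft P w v k).
  have -> : dft P w f k = Y - dft P w v k - h%:C *: A Y.
    rewrite /dft /Y (@opfun_sum (fun n => q ^+ n) (fun n => v n.+1)) //.
    rewrite scaler_sumr -!sumrB; apply: eq_bigr => n _.
    by rewrite /f !scalerBr !scalerA mulrC.
  rewrite !scalerBr qY scalerBl scale1r; congr (_ - _).
  rewrite -qY opfunZ; last exact: (@opdom_sum (fun n => q ^+ n) (fun n => v n.+1)).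
  by rewrite !scalerA mulrC.
apply: unit_circle_bound => //; exact: (@opdom_sum (fun n => q ^+ n)).
Qed.

End Operator.

(** * Operator norms and resolvent bounds *)

Section ResolventNorm.
Context {R : realType} {H : completeNormedModType R[i]}.
Implicit Types (T : H -> H) (A : operator H) (u v : H).

Lemma opnorm_le T (c : R) : 0 <= c -> (forall u, nrm (T u) <= c * nrm u) ->
  (opnorm T <= c%:E)%E.
Proof.
move=> c0 h; apply: ge_ereal_sup => _ [u /= u1 <-]; rewrite lee_fin.
apply: le_trans (h u) _; rewrite -[leRHS]mulr1 ler_wpM2l //.
by rewrite -lecR -nrmE.
Qed.

Lemma le_opnorm T u (c : R) : nrm u <= 1 -> c <= nrm (T u) -> (c%:E <= opnorm T)%E.
Proof.
move=> u1 h; apply: (@le_trans _ _ (nrm (T u))%:E); first by rewrite lee_fin.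
by apply: ereal_sup_ubound; exists u => //=; rewrite nrmE lecR.
Qed.

Lemma opnorm_ge0 T : (0 <= opnorm T)%E.
Proof. by apply: (@le_opnorm _ 0); rewrite ?nrm0 ?nrm_ge0 ?ler01. Qed.

Lemma le_opnormM T u (c : R) :
  (forall (a : R) v, T (a%:C *: v) = a%:C *: T v) ->
  (opnorm T <= c%:E)%E -> nrm (T u) <= c * nrm u.
Proof.
move=> hT hc; have [u0|un0] := eqVneq u 0.
  have -> : u = 0%:C *: 0 by rewrite scaler0.
  by rewrite hT scaler0 scale0r !nrm0 mulr0.
have nu : 0 < nrm u by rewrite lt_def nrm_eq0 un0 nrm_ge0.
rewrite mulrC -ler_pdivrMl //.
rewrite -[X in X * _]gtr0_norm ?invr_gt0 // -nrmZr -hT -lee_fin.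
apply: le_trans hc; apply: le_opnorm (lexx _).
by rewrite nrmZr gtr0_norm ?invr_gt0 // mulVf // gt_eqF.
Qed.

(** Uniqueness of the solution identifies the chosen inverse. *)
Lemma resolvent_eq A (z : R[i]) u v :
  (exists! u, opdom A u /\ z *: u - A u = v) ->
  opdom A u -> z *: u - A u = v -> resolvent A z v = u.
Proof.
move=> [u' [_ uniq_u']] hu huv.
have : [set u | opdom A u /\ z *: u - A u = v] (resolvent A z v).
  by apply: getPex; exists u.
by move=> /uniq_u' <-; exact: uniq_u'.
Qed.

Lemma resolventP A (z : R[i]) v : resolvent_set A z ->
  opdom A (resolvent A z v) /\ z *: resolvent A z v - A (resolvent A z v) = v.
Proof.
move=> [hz _]; have [u [[hu huv] _]] := hz v.
by rewrite (resolvent_eq (hz v) hu huv).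
Qed.

Lemma resolventZ A (z : R[i]) (a : R) v : resolvent_set A z ->
  resolvent A z (a%:C *: v) = a%:C *: resolvent A z v.
Proof.
move=> hz; have [hu huv] := resolventP v hz.
apply: resolvent_eq; [exact: hz.1|exact: opdomZ|].
by rewrite opfunZ // -[in RHS]huv scalerBr !scalerA mulrC.
Qed.

Lemma resolvent_norm_ge0 A (z : R[i]) : (0 <= resolvent_norm A z)%E.
Proof. by rewrite /resolvent_norm; case: ifP => _; [exact: leey|exact: opnorm_ge0]. Qed.

Let resolvent_sup A := ereal_sup [set resolvent_norm A z |
                      z in [set z : R[i] | 0 < complex.Re z]%R].

Lemma resolvent_norm_le_sup A (z : R[i]) : 0 < complex.Re z ->
  (resolvent_norm A z <= resolvent_sup A)%E.
Proof. by move=> hz; apply: ereal_sup_ubound; exists z. Qed.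

Lemma resolvent_sup_ge0 A : (0 <= resolvent_sup A)%E.
Proof.
apply: le_trans (resolvent_norm_ge0 A 1) _.
by apply: resolvent_norm_le_sup; rewrite /= ltr01.
Qed.

(** If the supremum of the resolvent norms is infinite or 0, then rA0 is 0 and
    there is nothing to prove; otherwise every such z is a resolvent point. *)
Lemma rA0_bound A (z : R[i]) u : 0 < complex.Re z -> opdom A u ->
  rA0 A * nrm u <= nrm (z *: u - A u).
Proof.
move=> hz hu; have := resolvent_norm_le_sup A hz; have := resolvent_sup_ge0 A.
rewrite /rA0 -/(resolvent_sup A).
case: (resolvent_sup A) => [r||] //=; last by rewrite mul0r nrm_ge0.
rewrite lee_fin le_eqVlt => /predU1P[<-|r0].
  by rewrite inve0 /= mul0r nrm_ge0.
rewrite inver gt_eqF //= ler_pdivrMl // /resolvent_norm.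
case: asboolP => // hsp hr.
have hres : resolvent_set A z by apply: contrapT.
rewrite -[in leLHS](resolvent_eq (hres.1 _) hu erefl).
by apply: le_opnormM => // a v; exact: resolventZ.
Qed.

(** Surjectivity and a lower bound c make every z of the open right half-plane
    a resolvent point with resolvent norm at most 1 / c. *)
Lemma rA0_ge A (c : R) : 0 < c -> (exists u : H, u != 0) ->
  (forall z : R[i], 0 < complex.Re z ->
    (forall v, exists2 u, opdom A u & z *: u - A u = v) /\
    (forall u, opdom A u -> c * nrm u <= nrm (z *: u - A u))) ->
  c <= rA0 A.
Proof.
move=> c0 [u0 u0n] hc.
have resolventE z : 0 < complex.Re z ->
    (forall v, exists! u, opdom A u /\ z *: u - A u = v) /\
    (opnorm (resolvent A z) <= c^-1%:E)%E.
  move=> hz; have [surj low] := hc z hz.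
  have inj u v : opdom A u -> opdom A v -> z *: u - A u = z *: v - A v -> u = v.
    move=> hu hv /eqP; rewrite -subr_eq0 => /eqP e; apply/eqP.
    rewrite -subr_eq0 -nrm_eq0 eq_le nrm_ge0 andbT -(pmulr_rle0 _ c0).
    have := low _ (opdomB hu hv).
    rewrite opfunB // scalerBr (_ : z *: u - z *: v - _ = 0) ?nrm0 //.
    by rewrite -e !opprB addrACA [RHS]addrACA (addrC (- _)).
  have uniq v : exists! u, opdom A u /\ z *: u - A u = v.
    have [u hu huv] := surj v; exists u; split=> // u' [hu' huv'].
    by apply: inj => //; rewrite huv huv'.
  split=> //; apply: opnorm_le => [|v]; first by rewrite invr_ge0 ltW.
  have [u hu huv] := surj v.
  by rewrite (resolvent_eq (uniq v) hu huv) -ler_pdivrMl ?invr_gt0 // invrK -huv low.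
have sup_le : (resolvent_sup A <= c^-1%:E)%E.
  apply: ge_ereal_sup => _ [z /= hz <-]; have [uniq le_c] := resolventE z hz.
  rewrite /resolvent_norm; case: asboolP => // -[].
  by split=> //; apply: le_lt_trans le_c (ltry _).
(* a resolvent is injective, so it does not vanish on a nonzero space *)
have sup_gt0 : (0 < resolvent_sup A)%E.
  rewrite lt_def resolvent_sup_ge0 andbT; apply/eqP => sup0.
  have h1 : 0 < complex.Re (1 : R[i]) by rewrite /= ltr01.
  have [uniq _] := resolventE 1 h1.
  have := resolvent_norm_le_sup A h1; rewrite sup0 /resolvent_norm.
  case: asboolP => [_|/contrapT hres]; first by rewrite leye_eq.
  move=> /(@le_opnormM _ u0) h0; have [_] := resolventP u0 hres.
  have /eqP : nrm (resolvent A 1 u0) == 0.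
    by rewrite eq_le nrm_ge0 andbT -[leRHS](mul0r (nrm u0)) h0 // => a v; exact: resolventZ.
  move=> /eqP; rewrite nrm_eq0 => /eqP ->; rewrite scaler0 opfun0 subr0 => e.
  by move: u0n; rewrite -e eqxx.
move: sup_gt0 sup_le; rewrite /rA0 -/(resolvent_sup A).
case: (resolvent_sup A) => [r||] //=; rewrite lte_fin lee_fin => r0 rc.
by rewrite inver gt_eqF //= -[c]invrK lef_pV2 ?posrE ?invr_gt0.
Qed.

End ResolventNorm.

(** * Contraction semigroups and implicit Euler steps *)

Section RealCvg.
Context {R : realType} {H : completeNormedModType R[i]}.

Lemma cvg_nrmP {T : Type} {F : set_system T} {FF : Filter F} (f : T -> H) (l : H) :
  f @ F --> l <-> forall e : R, 0 < e -> \forall t \near F, nrm (l - f t) < e.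
Proof.
split=> [/cvgrPdist_lt h e e0|h].
  have eC : 0 < e%:C by rewrite ltcR.
  by apply: filterS (h _ eC) => t; rewrite nrmE ltcR.
apply/cvgrPdist_lt => e e0.
have eE : e = (complex.Re e)%:C by rewrite RRe_real // gtr0_real.
have e1 : 0 < complex.Re e by rewrite -ltcR -eE.
by apply: filterS (h _ e1) => t; rewrite nrmE eE ltcR.
Qed.
End RealCvg.

Section Semigroup.
Context {R : realType} {H : completeNormedModType R[i]}.
Context (A : operator H) (S : R -> {linear H -> H}).
Hypothesis (SA : semigroup_of A S).
Implicit Types u v : H.

Lemma semigroup0 u : S 0 u = u.
Proof. by have [[]] := SA. Qed.

Lemma semigroupD s t u : 0 <= s -> 0 <= t -> S (s + t) u = S s (S t u).
Proof. by have [[_ h _ _] _] := SA => s0 t0; exact: h. Qed.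

Lemma semigroup_contr t u : 0 <= t -> nrm (S t u) <= nrm u.
Proof. by have [[_ _ _ h] _] := SA => t0; rewrite -lecR -!nrmE; exact: h. Qed.

Lemma semigroup_cvg0 u : (fun h => S h u) @ 0^'+ --> u.
Proof.
have [[_ _ /(_ u)/subspace_continuousP/(_ 0 (lexx _)) h _] _] := SA.
move: h; rewrite /from_subspace /= semigroup0; apply: cvg_trans; apply: cvg_app.
by apply: within_subset => t /= /ltW.
Qed.

(** The semigroup commutes with its difference quotients, and is continuous. *)
Lemma semigroup_generator t u : 0 <= t -> opdom A u ->
  opdom A (S t u) /\ A (S t u) = S t (A u).
Proof.
move=> t0 hu; have [_ gen] := SA; apply/gen/cvg_nrmP => e e0.
have /gen/cvg_nrmP/(_ _ e0) : opdom A u /\ A u = A u by [].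
apply: filterS2 (nbhs_right_gt 0) => h h0; apply: le_lt_trans.
rewrite -semigroupD ?(ltW h0) // (addrC h) semigroupD ?(ltW h0) //.
have -> : S t (A u) - h^-1%:C *: (S t (S h u) - S t u) =
    S t (A u - h^-1%:C *: (S h u - u))
  by rewrite [RHS]raddfB [X in _ = _ - X]linearZ /= [X in _ = _ - _ *: X]raddfB.
by rewrite semigroup_contr.
Qed.

(** Both (S h u - u) / h and S h (A u) tend to A u.  Applying the contraction S (n h)
    then bounds the error at every time step by the same quantity. *)
Lemma implicit_euler_error u (e : R) : 0 < e -> opdom A u ->
  \forall h \near 0^'+, nrm (S h u - u - h%:C *: A (S h u)) <= e * h.
Proof.
move=> e0 hu; have [_ gen] := SA.
have e2 : 0 < e / 2 by rewrite divr_gt0.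
have /gen/cvg_nrmP/(_ _ e2) h1 : opdom A u /\ A u = A u by [].
have /cvg_nrmP/(_ _ e2) h2 := @semigroup_cvg0 (A u).
near=> h; have h0 : 0 < h by near: h; exact: nbhs_right_gt.
have [_ ->] := semigroup_generator (ltW h0) hu.
have -> : S h u - u - h%:C *: S h (A u) =
   h%:C *: ((A u - S h (A u)) - (A u - h^-1%:C *: (S h u - u))).
  rewrite [in RHS]opprB [X in _ = _ *: X]addrC addrA subrK scalerBr scalerA.
  by rewrite -rmorphM /= divff ?gt_eqF // scale1r.
rewrite nrmZr (gtr0_norm h0) mulrC ler_pM2r //.
apply: le_trans (nrmD _ _) _; rewrite nrmN [leRHS]splitr lerD // ltW //.
  by near: h.
by near: h.
Unshelve. all: by end_near.
Qed.

End Semigroup.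

(** * Decay of the semigroup *)

Section Decay.
Context {R : realType} {H : completeNormedModType R[i]}.
Context (dot : {dot H for Num.conj}) (A : operator H) (S : R -> {linear H -> H}).
Hypotheses (hdot : hilbert_product dot) (SA : semigroup_of A S).
Implicit Types u v : H.
Context (r : R) (r_gt0 : 0 < r).
Hypothesis resolvent_bound : forall z : R[i], 0 < complex.Re z ->
  forall u, opdom A u -> r * nrm u <= nrm (z *: u - A u).

Lemma semigroup_anti s t u : 0 <= s -> s <= t -> nrm (S t u) <= nrm (S s u).
Proof.
move=> s0 st; rewrite -(subrK s t) (semigroupD SA) ?subr_ge0 //.
by rewrite (semigroup_contr SA) // subr_ge0.
Qed.

(** The defect of the sequence c n u(n h) is the increment of c times u(n h), plus an
    Euler error weighted by c. *)
Lemma cutoff_energy (c : nat -> R) (P : nat) (h d eps : R) u :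
  (0 < P)%N -> c 0%N = 0 -> c P = 0 -> 0 < h -> 0 < d -> 0 <= eps -> opdom A u ->
  nrm (S h u - u - h%:C *: A (S h u)) <= eps * h ->
  (h * r) ^+ 2 * \sum_(n < P) c n ^+ 2 * nrm (S (n%:R * h) u) ^+ 2 <=
  (1 + d) * \sum_(n < P) (c n.+1 - c n) ^+ 2 * nrm (S (n%:R * h) u) ^+ 2 +
  (1 + d^-1) * (eps * h) ^+ 2 * \sum_(n < P) c n ^+ 2.
Proof.
move=> P0 c0 cP h0 d0 eps0 hu herr.
have nh0 n : 0 <= n%:R * h by rewrite mulr_ge0 // ltW.
pose v n := (c n)%:C *: S (n%:R * h) u.
have vD n : opdom A (v n).
  by apply: opdomZ; have [] := semigroup_generator SA (nh0 n) hu.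
have v0 : v 0%N = 0 by rewrite /v c0 scale0r.
have vP : v P = 0 by rewrite /v cP scale0r.
have := energy_inequality resolvent_bound hdot P0 h0 (ltW r_gt0) vD v0 vP.
rewrite (eq_bigr (fun n : 'I_P => c n ^+ 2 * nrm (S (n%:R * h) u) ^+ 2)); last first.
  by move=> n _; rewrite nrmZr exprMn real_normK // num_real.
move/le_trans; apply.
have -> : \sum_(n < P) c n ^+ 2 = \sum_(n < P) c n.+1 ^+ 2.
  transitivity (\sum_(n < P.+1) c n ^+ 2).
    by rewrite big_ord_recr /= cP expr0n addr0.
  by rewrite big_ord_recl /= c0 expr0n add0r.
rewrite !mulr_sumr -big_split /=; apply: ler_sum => n _.
have -> : v n.+1 - v n - h%:C *: A (v n.+1) =
   (c n.+1 - c n)%:C *: S (n%:R * h) u +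
   (c n.+1)%:C *: S (n%:R * h) (S h u - u - h%:C *: A (S h u)).
  have uS : S (n.+1%:R * h) u = S (n%:R * h) (S h u).
    by rewrite -natr1 mulrDl mul1r (semigroupD SA) // ltW.
  have [hSu hASu] := semigroup_generator SA (ltW h0) hu.
  have [hnSu hAnSu] := semigroup_generator SA (nh0 n) hSu.
  have -> : S (n%:R * h) (S h u - u - h%:C *: A (S h u)) =
      S (n%:R * h) (S h u) - S (n%:R * h) u - h%:C *: A (S (n%:R * h) (S h u)).
    by rewrite hAnSu [LHS]raddfB [X in X - _]raddfB [X in _ - X]linearZ.
  rewrite /v uS opfunZ // rmorphB /= scalerBl !scalerBr !scalerA (mulrC h%:C).
  by rewrite [RHS]addrC [in RHS](addrAC (_ *: S (n%:R * h) (S h u))) [RHS]addrA subrK addrAC.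
apply: le_trans (nrmD_sqr _ _ d0) _.
rewrite !nrmZr [(`|c n.+1 - c n| * _) ^+ 2]exprMn [(`|c n.+1| * _) ^+ 2]exprMn.
rewrite !real_normK ?num_real // lerD2l -(mulrA (1 + d^-1)).
rewrite ler_wpM2l ?addr_ge0 ?invr_ge0 ?(ltW d0) // [leRHS]mulrC.
apply: ler_wpM2l; first exact: sqr_ge0.
rewrite ler_sqr ?nnegrE ?nrm_ge0 ?mulr_ge0 ?(ltW h0) //.
by apply: le_trans herr; rewrite (semigroup_contr SA).
Qed.

(** The factor 1 + d lost by separating the Euler error is absorbed in the rate:
    the chord x is h times a rate slightly smaller than r. *)
Lemma discrete_decay (K J : nat) (h d eps T : R) u :
  let th := pi / 4 / K%:R in let x := 2 * sin (th / 2) in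
  (0 < K)%N -> 0 < h -> 0 < d -> 0 <= eps -> opdom A u ->
  (h * r) ^+ 2 = (1 + d) * x ^+ 2 ->
  nrm (S h u - u - h%:C *: A (S h u)) <= eps * h ->
  (K + J + K)%:R * h <= T ->
  ((1 + x) ^+ J) ^+ 2 * (1 - x) * nrm (S T u) ^+ 2 <=
  nrm u ^+ 2 + 2 * (d^-1 * (eps * h) ^+ 2) * (4 * K + J)%:R * ((1 + x) ^+ J) ^+ 2 / x.
Proof.
move=> th x K0 h0 d0 eps0 hu hx herr hT.
have thK : th * K%:R = pi / 4 by rewrite divfK // pnatr_eq0 -lt0n.
have nh0 n : 0 <= n%:R * h by rewrite mulr_ge0 // ltW.
pose N n := nrm (S (n%:R * h) u) ^+ 2.
have Nmono m n : (m <= n)%N -> N n <= N m.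
  move=> mn; rewrite ler_sqr ?nnegrE ?nrm_ge0 // semigroup_anti //.
  by rewrite ler_wpM2r ?ler_nat // ltW.
have P0 : (0 < K + J + (K + (K + K)))%N by rewrite -addnA ltn_addr.
have := @cutoff_energy (cutoff th K J) _ h d eps u P0
   (cutoff0 J thK) (cutoff_end J thK) h0 d0 eps0 hu herr.
rewrite hx => energy.
have d1 : 0 < 1 + d by rewrite addr_gt0.
have e0 : 0 <= d^-1 * (eps * h) ^+ 2 by rewrite mulr_ge0 ?invr_ge0 ?sqr_ge0 ?(ltW d0).
have decay := @decay_of_sum_bound _ th K J K0 thK N _ e0 _ Nmono.
have x1 : 0 <= 1 - x.
  have := angle_le K0 thK; have := angle_gt0 K0 thK; have := @pi_gt0 R.
  have := @pihalf_lt2 R.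
  move=> p2 p0 t0 t1; have /andP[_] := @sin_bounds R (th / 2) ltac:(apply/andP; split; lra).
  rewrite /x; lra.
apply: (@le_trans _ _ (((1 + x) ^+ J) ^+ 2 * (1 - x) * N (K + J + K)%N)).
  rewrite ler_wpM2l //; first by rewrite mulr_ge0 // sqr_ge0.
  by rewrite ler_sqr ?nnegrE ?nrm_ge0 // semigroup_anti.
have -> : nrm u ^+ 2 = N 0%N by rewrite /N mul0r (semigroup0 SA).
apply: decay; first by move=> n; exact: sqr_ge0.
rewrite -(ler_pM2l d1) mulrA; apply: le_trans energy _.
rewrite mulrDr lerD2l [leRHS]mulrA (_ : (1 + d^-1) * (eps * h) ^+ 2 =
  (1 + d) * (d^-1 * (eps * h) ^+ 2)) //.
by field; rewrite gt_eqF.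
Qed.

(** On a fine mesh, J is the number of steps left in [0, T] when the two arcs of
    length pi / 4 have been removed. *)
Lemma mesh_decay (s T eps : R) u : 0 < s < r -> pi / 2 < s * T -> 0 < eps -> opdom A u ->
  \forall n \near \oo, (1 - mesh n) * nrm (S T u) ^+ 2 <=
    nrm u ^+ 2 * expR (- (2 * (s * T - pi / 2 - mesh n) / (1 + mesh n))) +
    2 * ((r / s) ^+ 2 - 1)^-1 * ((T + pi / 2 / s) / s) * eps ^+ 2.
Proof.
move=> /andP[s0 sr] hT eps0 hu; set d := (r / s) ^+ 2 - 1.
have d0 : 0 < d by rewrite subr_gt0 exprn_egt1 // ltr_pdivlMr // mul1r.
have cvgh : (fun n => mesh n / s) @ \oo --> (0 : R).
  by rewrite -[X in _ --> X](mul0r s^-1); apply: cvgMl; exact: cvg_mesh.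
have q0 : 0 < s * T - pi / 2 by rewrite subr_gt0.
have near_small : \forall n \near \oo, mesh n < s * T - pi / 2.
  by apply: cvgr_lt q0; exact: cvg_mesh.
have near_error := cvgh _ (implicit_euler_error SA eps0 hu).
apply: filterS2 near_small near_error => n.
pose x := mesh n : R; pose K := n.+1; pose h := x / s.
rewrite /= -/x -/h => xT /= herr'.
have x0 : 0 < x := mesh_gt0 n.
have h0 : 0 < h by rewrite divr_gt0.
have hs : h * s = x by rewrite divfK ?gt_eqF.
have herr := herr' h0.
have T0 : 0 <= T / h.
  rewrite divr_ge0 ?(ltW h0) // ltW // -(pmulr_rgt0 _ s0).
  by apply: lt_trans hT; rewrite divr_gt0 ?pi_gt0.
(* M is the index of the last grid point before T; the maximum of the cut-off is
   placed there. *)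
pose M := Num.truncn (T / h).
have /andP[] := truncn_itv T0; rewrite -/M ler_pdivlMr // ltr_pdivrMr // => M1 M2.
have K2 : 2 * K%:R * x <= pi / 2.
  have K0 : (0 : R) < K%:R by rewrite ltr0n.
  have := @mesh_le R n; rewrite -/x -/K ler_pdivlMr // => le_x.
  lra.
have M3 : s * T < M%:R * x + x.
  have -> : M%:R * x + x = s * (M.+1%:R * h) by rewrite -hs -natr1; ring.
  by rewrite ltr_pM2l.
have KM : (K + K <= M)%N.
  rewrite -(ler_nat R) -(ler_pM2r x0) natrD; lra.
pose J := (M - (K + K))%N.
have MJ : M%:R = J%:R + 2 * K%:R :> R by rewrite natrB // natrD; ring.
have Jx : s * T - pi / 2 - x <= J%:R * x.
  have -> : J%:R * x = M%:R * x - 2 * K%:R * x by rewrite MJ; ring.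
  lra.
have hKJ : (K + J + K)%:R * h <= T by rewrite addnAC subnKC.
have hd : (h * r) ^+ 2 = (1 + d) * x ^+ 2.
  by rewrite /h /d; field; rewrite gt_eqF.
have := discrete_decay (ltn0Sn n) h0 d0 (ltW eps0) hu hd herr hKJ.
rewrite -/(mesh n) -/x.
set C2 := _ ^+ 2; have C0 : 0 < C2 by rewrite exprn_gt0 // exprn_gt0 // addr_gt0.
rewrite -/K => main.
rewrite -(ler_pM2l C0) mulrA; apply: le_trans main _.
rewrite mulrDr lerD //.
  rewrite mulrCA ler_peMr ?sqr_ge0 // mulrC expRN ler_pdivlMl ?expR_gt0 // mulr1.
  rewrite (_ : 2 * _ / _ = (s * T - pi / 2 - x) / (1 + x) *+ 2); last first.
    by rewrite mulr2n; field; rewrite gt_eqF ?addr_gt0.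
  rewrite -mulr_natl expRM_natl ler_sqr ?nnegrE ?expR_ge0 ?exprn_ge0 ?addr_ge0 ?(ltW x0) //.
  apply: le_trans (expR_le_growth J (ltW x0)); rewrite ler_expR.
  by rewrite ler_pM2r ?invr_gt0 ?addr_gt0.
have -> : 2 * (d^-1 * (eps * h) ^+ 2) * (4 * K + J)%:R * C2 / x =
  C2 * (2 * d^-1 * ((h * (M%:R + 2 * K%:R)) / s) * eps ^+ 2).
  rewrite natrD natrM MJ -hs; field.
  by rewrite !gt_eqF.
rewrite ler_pM2l // ler_wpM2r ?sqr_ge0 // ler_wpM2l ?mulr_ge0 ?invr_ge0 ?(ltW d0) //.
rewrite ler_pM2r ?invr_gt0 // mulrDr lerD //; first by rewrite mulrC.
by rewrite ler_pdivlMr // mulrAC hs mulrC.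
Qed.

(** The mesh is refined first, for a fixed rate s < r and a fixed relative Euler
    error, and then that error tends to 0. *)
Lemma decay_below (s T : R) u : 0 < s < r -> pi / 2 < s * T -> opdom A u ->
  nrm (S T u) ^+ 2 <= nrm u ^+ 2 * expR (- (2 * (s * T - pi / 2))).
Proof.
move=> sr hT hu; apply/ler_addgt0Pr => e e0.
have /andP[s0 s1] := sr.
set B := 2 * ((r / s) ^+ 2 - 1)^-1 * ((T + pi / 2 / s) / s).
have B0 : 0 < B.
  have T0 : 0 < T.
    rewrite -(pmulr_rgt0 _ s0); apply: lt_trans hT.
    by rewrite divr_gt0 ?pi_gt0.
  rewrite !mulr_gt0 ?invr_gt0 ?subr_gt0 ?exprn_egt1 ?ltr_pdivlMr ?mul1r //.
  by rewrite addr_gt0 ?divr_gt0 ?pi_gt0.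
(* With this relative error the remainder is exactly e. *)
have eps0 : 0 < Num.sqrt (e / B) by rewrite sqrtr_gt0 divr_gt0.
have := mesh_decay sr hT eps0 hu; rewrite -/B sqr_sqrtr ?(ltW (divr_gt0 e0 B0)) //.
rewrite (mulrC B) divfK ?gt_eqF // => hn.
apply: (ler_cvg_to _ _ hn).
  rewrite -[X in _ --> X]mul1r; apply: cvgMl.
  by rewrite -[X in _ --> X]subr0; apply: cvgB; [exact: cvg_cst|exact: cvg_mesh].
apply: cvgD; last exact: cvg_cst.
apply: cvgMr.
apply: (@cvg_comp _ _ _ _ expR); last exact: continuous_expR.
apply: cvgN.
have -> : 2 * (s * T - pi / 2) = 2 * (s * T - pi / 2) / (1 + 0) by rewrite addr0 divr1.
apply: cvgM.
  apply: cvgMr; rewrite -[X in _ --> X]subr0.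
  by apply: cvgB; [exact: cvg_cst|exact: cvg_mesh].
apply: cvgV; first by rewrite addr0 oner_eq0.
by apply: cvgD; [exact: cvg_cst|exact: cvg_mesh].
Qed.

End Decay.

Section UpperBound.
Context {R : realType} {H : completeNormedModType R[i]}.
Context (dot : {dot H for Num.conj}) (A : operator H) (S : R -> {linear H -> H}).
Hypotheses (hdot : hilbert_product dot) (SA : semigroup_of A S).
Implicit Types u v : H.

(** For r T <= pi / 2 contractivity is enough; otherwise s tends to r from below. *)
Lemma decay_domain (T : R) u : 0 <= T -> opdom A u ->
  nrm (S T u) <= expR (pi / 2 - rA0 A * T) * nrm u.
Proof.
move=> T0 hu; set r := rA0 A.
have [small|large] := lerP (r * T) (pi / 2).
  apply: le_trans (semigroup_contr SA u T0) _.
  by rewrite ler_peMl ?nrm_ge0 // -[leLHS]expR0 ler_expR subr_ge0.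
have rT : 0 < r * T.
  by apply: lt_trans large; rewrite divr_gt0 ?pi_gt0.
have T1 : 0 < T.
  rewrite lt_def T0 andbT; apply/eqP => T00.
  by move: rT; rewrite T00 mulr0 ltxx.
have r0 : 0 < r by rewrite -(pmulr_lgt0 _ T1).
rewrite -ler_sqr ?nnegrE ?nrm_ge0 ?mulr_ge0 ?expR_ge0 ?nrm_ge0 // exprMn -expRM_natl.
have -> : 2 * (pi / 2 - r * T) = - (2 * (r * T - pi / 2)) by ring.
rewrite mulrC.
pose F s := nrm u ^+ 2 * expR (- (2 * (s * T - pi / 2))).
have cF : F s @[s --> r^'-] --> F r.
  apply: cvg_at_left_filter; apply: cvgMr.
  apply: (@cvg_comp _ _ _ _ expR); last exact: continuous_expR.
  apply: cvgN; apply: cvgMr; apply: cvgB; last exact: cvg_cst.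
  by apply: cvgMl; exact: cvg_id.
apply: (cvgr_to_ge cF); near=> s.
have bound z (hz : 0 < complex.Re z) v (hv : opdom A v) := rA0_bound hz hv.
apply: (decay_below hdot SA r0 bound) => //.
  apply/andP; split; last by near: s; exact: nbhs_left_lt.
  by near: s; exact: nbhs_left_gt.
rewrite -ltr_pdivrMr //; near: s; apply: nbhs_left_gt.
by rewrite ltr_pdivrMr.
Unshelve. all: by end_near.
Qed.

Lemma decay (T : R) u : dense (opdom A) -> 0 <= T ->
  nrm (S T u) <= expR (pi / 2 - rA0 A * T) * nrm u.
Proof.
move=> hD T0; set c := expR _; apply/ler_addgt0Pr => e e0.
have c0 : 0 < c := expR_gt0 _.
pose d := e / (c + 1).
have d0 : 0 < d by rewrite divr_gt0 ?addr_gt0.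
have [v [/= hv hvD]] : ball u d%:C `&` opdom A !=set0.
  apply: hD; last by apply: ball_open; rewrite ltcR.
  by exists u; apply: ballxx; rewrite ltcR.
have huv : nrm (u - v) < d.
  by move: hv; rewrite -ball_normE /= nrmE ltcR.
rewrite -[in leLHS](subrK v u) raddfD; apply: le_trans (nrmD _ _) _.
apply: (@le_trans _ _ (d + c * nrm v)).
  by rewrite lerD ?decay_domain // (le_trans (semigroup_contr SA _ T0)) // ltW.
have nv : nrm v <= nrm u + d.
  rewrite -[in leLHS](subrK u v) addrC; apply: le_trans (nrmD _ _) _.
  by rewrite lerD2l nrmB ltW.
apply: (@le_trans _ _ (d + c * (nrm u + d))).
  by rewrite lerD2l ler_wpM2l // ltW.
have -> : e = d * (c + 1) by rewrite divfK // gt_eqF // addr_gt0.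
by rewrite le_eqVlt; apply/orP; left; apply/eqP; ring.
Qed.

Lemma weighted_opnorm_le (T : R) : dense (opdom A) -> 0 <= T ->
  ((expR (rA0 A * T))%:E * opnorm (S T) <= (expR (pi / 2))%:E)%E.
Proof.
move=> hD T0.
have h : (opnorm (S T) <= (expR (pi / 2 - rA0 A * T))%:E)%E.
  apply: opnorm_le; first exact: expR_ge0.
  by move=> u; exact: decay.
apply: (@le_trans _ _ ((expR (rA0 A * T))%:E * (expR (pi / 2 - rA0 A * T))%:E)%E).
  by rewrite lee_wpmul2l // lee_fin expR_ge0.
by rewrite -EFinM -expRD lee_fin addrC subrK.
Qed.

End UpperBound.

(** * Discrete Wirtinger inequality *)

Section Wirtinger.
Context {R : realType} (d : nat) (d_gt0 : (0 < d)%N).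
Let th : R := pi / (2 * d + 1)%:R.

(** The inverse of the norm of the summation operator on C^d. *)
Definition volterra_gap : R := 2 * sin (th / 2).
Let c := volterra_gap.

Let d1_gt0 : 0 < (2 * d + 1)%:R :> R.
Proof. by rewrite ltr0n addn1. Qed.

Lemma wirtinger_angle_gt0 : 0 < th.
Proof. by rewrite divr_gt0 ?pi_gt0. Qed.

Lemma wirtinger_angleE : (2 * d + 1)%:R * th = pi.
Proof. by rewrite mulrC divfK // gt_eqF. Qed.

Let s j : R := sin (j%:R * th).

Lemma wirtinger_sin_gt0 k : (0 < k <= 2 * d)%N -> 0 < s k.
Proof.
move=> /andP[k0 kd]; apply: sin_gt0_pi; have t0 := wirtinger_angle_gt0.
by rewrite mulr_gt0 ?ltr0n //= -wirtinger_angleE ltr_pM2r // ltr_nat addn1 ltnS.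
Qed.

Lemma volterra_gap_gt0 : 0 < c.
Proof.
have t0 := wirtinger_angle_gt0.
have t1 : th <= pi by rewrite ler_pdivrMr // ler_peMr ?pi_ge0 // ler1n addn1.
by rewrite mulr_gt0 // sin_gt0_pi //; apply/andP; split; lra.
Qed.

Lemma sqr_volterra_gap : c ^+ 2 = 2 - 2 * cos th.
Proof. by rewrite cos_step /c /volterra_gap; field. Qed.

(** A discrete Picone identity: the difference of the two sides is the square of
    p s_{k+1} - q s_k, divided by s_k s_{k+1}. *)
Lemma wirtinger_step (k : nat) (p q : R) : (0 < k <= 2 * d)%N -> (k.+1 <= 2 * d)%N ->
  c ^+ 2 * q ^+ 2 + q ^+ 2 * (s k.+2 / s k.+1 - 1) <=
  (q - p) ^+ 2 + p ^+ 2 * (s k.+1 / s k - 1).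
Proof.
move=> hk hk1; have sk : 0 < s k := wirtinger_sin_gt0 hk.
have sk1 : 0 < s k.+1 by apply: wirtinger_sin_gt0; rewrite hk1.
have s2 : s k.+2 = 2 * cos th * s k.+1 - s k.
  rewrite /s; have -> : k.+2%:R * th = k.+1%:R * th + th by rewrite -[k.+2%:R]natr1; ring.
  have -> : k%:R * th = k.+1%:R * th - th by rewrite -[k.+1%:R]natr1; ring.
  by rewrite sinB sinD; ring.
rewrite s2 sqr_volterra_gap -subr_ge0.
have -> : (q - p) ^+ 2 + p ^+ 2 * (s k.+1 / s k - 1) -
   ((2 - 2 * cos th) * q ^+ 2 + q ^+ 2 * ((2 * cos th * s k.+1 - s k) / s k.+1 - 1))
   = (p * s k.+1 - q * s k) ^+ 2 / (s k * s k.+1).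
  by field; rewrite !gt_eqF.
by rewrite divr_ge0 ?sqr_ge0 // mulr_ge0 // ltW.
Qed.

(** Dirichlet condition at 0 and Neumann condition at d: the angle is such that
    s_{d+1} = s_d, so the last boundary term of the telescoping bound vanishes. *)
Lemma discrete_wirtinger (b : nat -> R) : b 0%N = 0 ->
  c ^+ 2 * \sum_(j < d) b j.+1 ^+ 2 <= \sum_(j < d) (b j.+1 - b j) ^+ 2.
Proof.
move=> b0.
have ind k : (k < d)%N -> c ^+ 2 * \sum_(j < k.+1) b j.+1 ^+ 2 +
    b k.+1 ^+ 2 * (s k.+2 / s k.+1 - 1) <= \sum_(j < k.+1) (b j.+1 - b j) ^+ 2.
  elim: k => [|k IH] hk.
    rewrite !big_ord_recl !big_ord0 /= !addr0 b0 subr0.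
    have s1 : 0 < s 1%N by apply: wirtinger_sin_gt0; rewrite muln_gt0.
    have -> : s 2%N = 2 * cos th * s 1%N.
      by rewrite /s mulrDl mul1r sinD; ring.
    rewrite sqr_volterra_gap mulfK ?gt_eqF // le_eqVlt; apply/orP; left.
    by apply/eqP; ring.
  rewrite big_ord_recr [in leRHS]big_ord_recr /=.
  have := IH (ltnW hk); have hk1 : (0 < k.+1 <= 2 * d)%N by lia.
  have hk2 : (k.+2 <= 2 * d)%N by lia.
  have := @wirtinger_step k.+1 (b k.+1) (b k.+2) hk1 hk2.
  rewrite mulrDr; lra.
have := ind d.-1; rewrite prednK // => /(_ (leqnn _)); apply: le_trans.
rewrite lerDl mulr_ge0 ?sqr_ge0 // subr_ge0.
suff -> : s d.+1 = s d by rewrite divff // gt_eqF // wirtinger_sin_gt0 // d_gt0 leq_pmull.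
rewrite /s; have -> : d.+1%:R * th = pi - d%:R * th.
  by rewrite -wirtinger_angleE natrD natrM -natr1; ring.
by rewrite sinB sinpi cospi; ring.
Qed.

(** A sequence with increments at most g is dominated by the partial sums of g,
    which are subject to the Wirtinger inequality. *)
Lemma volterra_bound (a g : nat -> R) :
  (forall j, 0 <= a j) -> (forall j, 0 <= g j) ->
  a 0%N <= g 0%N -> (forall j, a j.+1 <= a j + g j.+1) ->
  c ^+ 2 * \sum_(j < d) a j ^+ 2 <= \sum_(j < d) g j ^+ 2.
Proof.
move=> a0 g0 ag0 ag; pose b j := \sum_(i < j) g i.
have ab j : a j <= b j.+1.
  elim: j => [|j IH]; first by rewrite /b big_ord_recl big_ord0 addr0.
  by rewrite /b big_ord_recr /=; apply: le_trans (ag j) _; rewrite lerD2r.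
have := @discrete_wirtinger b (big_ord0 _ _ _ _).
have -> : \sum_(j < d) (b j.+1 - b j) ^+ 2 = \sum_(j < d) g j ^+ 2.
  by apply: eq_bigr => j _; rewrite /b big_ord_recr /= addrAC subrr add0r.
apply: le_trans; rewrite ler_wpM2l ?sqr_ge0 //; apply: ler_sum => j _.
by rewrite ler_sqr ?nnegrE // /b sumr_ge0.
Qed.

End Wirtinger.


(** * Poisson weights *)

Section Poisson.
Context {R : realType}.

Definition poisson_weight (k : nat) (t : R) : R := expR (- t) * (t ^+ k / k`!%:R).

Lemma poisson_weight_ge0 k t : 0 <= t -> 0 <= poisson_weight k t.
Proof. by move=> t0; rewrite mulr_ge0 ?expR_ge0 // divr_ge0 ?exprn_ge0. Qed.

Lemma poisson_weightS k t : k.+1%:R * poisson_weight k.+1 t = t * poisson_weight k t.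
Proof.
rewrite /poisson_weight factS natrM exprS; field.
by rewrite pnatr_eq0 -lt0n fact_gt0 nat1r pnatr_eq0.
Qed.

(** The sum of two independent Poisson variables is Poisson: binomial theorem. *)
Lemma poisson_weightD k s t :
  \sum_(i < k.+1) poisson_weight i s * poisson_weight (k - i) t = poisson_weight k (s + t).
Proof.
rewrite /poisson_weight addrC opprD expRD exprDn mulr_suml mulr_sumr.
apply: eq_bigr => i _; have ik : (i <= k)%N by rewrite -ltnS.
rewrite -[_ *+ 'C(k, i)]mulr_natr.
have -> : 'C(k, i)%:R = k`!%:R / (i`!%:R * (k - i)`!%:R) :> R.
  rewrite -(bin_fact ik) !natrM mulfK // mulf_neq0 // pnatr_eq0 -lt0n fact_gt0.
by field; rewrite !pnatr_eq0 -!lt0n !fact_gt0.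
Qed.

Lemma poisson_partial_sum K t :
  \sum_(k < K) poisson_weight k t = expR (- t) * series (exp_coeff t) K.
Proof. by rewrite /series /= big_mkord mulr_sumr. Qed.

Lemma poisson_sum_le1 K t : 0 <= t -> \sum_(k < K) poisson_weight k t <= 1.
Proof.
move=> t0; rewrite poisson_partial_sum expRN mulrC ler_pdivrMr ?expR_gt0 // mul1r.
apply: nondecreasing_cvgn_le (is_cvg_series_exp_coeff t) K.
apply/nondecreasing_seqP => n; rewrite /series /= big_nat_recr //= lerDl.
by rewrite divr_ge0 ?exprn_ge0.
Qed.

Lemma cvg_poisson_sum t : (\sum_(k < K) poisson_weight k t) @[K --> \oo] --> (1 : R).
Proof.
under eq_fun do rewrite poisson_partial_sum.
have -> : (1 : R) = expR (- t) * expR t by rewrite -expRD addNr expR0.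
by apply: cvgMr; exact: is_cvg_series_exp_coeff.
Qed.

Let Q t K := \sum_(k < K) poisson_weight k t.

Lemma poisson_first_moment K t :
  \sum_(k < K.+1) k%:R * poisson_weight k t = t * Q t K.
Proof.
rewrite big_ord_recl mul0r add0r mulr_sumr.
by apply: eq_bigr => k _; rewrite poisson_weightS.
Qed.

Lemma poisson_second_moment K t :
  \sum_(k < K.+2) (k%:R * (k%:R - 1)) * poisson_weight k t = t ^+ 2 * Q t K.
Proof.
rewrite big_ord_recl mul0r mul0r add0r expr2 -mulrA -poisson_first_moment mulr_sumr.
apply: eq_bigr => k _; rewrite lift0 -[k.+1%:R]natr1 addrK natr1 mulrAC.
by rewrite poisson_weightS; ring.
Qed.

(** Truncated sums of the squared deviation are expressed by truncated sums of the
    weights, so the variance is obtained without interchanging limits. *)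
Lemma poisson_variance K t :
  \sum_(k < K.+2) (k%:R - t) ^+ 2 * poisson_weight k t =
  t ^+ 2 * Q t K + (1 - 2 * t) * (t * Q t K.+1) + t ^+ 2 * Q t K.+2.
Proof.
rewrite -poisson_first_moment -poisson_second_moment /Q !mulr_sumr -!big_split /=.
by apply: eq_bigr => k _; ring.
Qed.

(** The expected deviation of a Poisson variable from its mean b^2 is at most its
    standard deviation b.  Truncating the sum at L is harmless because the omitted
    terms are nonpositive. *)
Lemma poisson_tent (b m L : nat) : (0 < b)%N -> (b ^ 2 + m <= L)%N ->
  m%:R - b%:R <= \sum_(k < L) poisson_weight k (b ^ 2)%:R * (m%:R - `|k%:R - (b ^ 2)%:R|).
Proof.
move=> b0 hL; set t : R := (b ^ 2)%:R; have t0 : 0 <= t by rewrite ler0n.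
have bR : 0 < b%:R :> R by rewrite ltr0n.
pose w k := poisson_weight k t.
pose f K := (m%:R - b%:R / 2) * Q t K.+2 - (2 * b%:R)^-1 *
   (t ^+ 2 * Q t K + (1 - 2 * t) * (t * Q t K.+1) + t ^+ 2 * Q t K.+2).
have cQ := cvg_poisson_sum t.
have cQ1 : Q t n.+1 @[n --> \oo] --> (1 : R) by rewrite cvg_shiftS.
have cQ2 : Q t n.+2 @[n --> \oo] --> (1 : R).
  by rewrite (cvg_shiftS (fun n => Q t n.+1)).
have cf : f K @[K --> \oo] --> (m%:R - b%:R : R).
  have -> : m%:R - b%:R = (m%:R - b%:R / 2) * 1 - (2 * b%:R)^-1 *
     (t ^+ 2 * 1 + (1 - 2 * t) * (t * 1) + t ^+ 2 * 1).
    by rewrite /t natrX; field; rewrite gt_eqF.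
  apply: cvgB; first exact: cvgMr.
  apply: cvgMr; apply: cvgD; last exact: cvgMr.
  by apply: cvgD; [exact: cvgMr|apply: cvgMr; exact: cvgMr].
apply: (cvgr_to_le cf); near=> K.
have LK : (L <= K.+2)%N.
  by do 2!apply: leqW; near: K; exists L.
have -> : f K = \sum_(k < K.+2) w k * (m%:R - b%:R / 2 - (2 * b%:R)^-1 * (k%:R - t) ^+ 2).
  rewrite /f -poisson_variance /Q !mulr_sumr -sumrB; apply: eq_bigr => k _.
  by rewrite /w; ring.
(* The absolute deviation y satisfies y <= b / 2 + y^2 / (2 b). *)
apply: (@le_trans _ _ (\sum_(k < K.+2) w k * (m%:R - `|k%:R - t|))).
  apply: ler_sum => k _; rewrite ler_wpM2l ?poisson_weight_ge0 //.
  rewrite -(@real_normK _ (k%:R - t)) ?num_real //; set y := `|_|.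
  rewrite -subr_ge0.
  have -> : m%:R - y - (m%:R - b%:R / 2 - (2 * b%:R)^-1 * y ^+ 2) =
    (2 * b%:R)^-1 * (y - b%:R) ^+ 2 by field; rewrite gt_eqF.
  by rewrite mulr_ge0 ?sqr_ge0 // invr_ge0 mulr_ge0 // ltW.
rewrite -(subnKC LK) big_split_ord /= gerDl; apply: sumr_le0 => k _.
rewrite mulr_ge0_le0 ?poisson_weight_ge0 // subr_le0.
apply: le_trans (ler_norm _); rewrite lerBrDr -natrD ler_nat; lia.
Unshelve. all: by end_near.
Qed.

End Poisson.


(** * Asymptotics of the extremal values *)

Lemma optimal_rate_cvg {R : realType} :
  (expR (pi * cos (harmonic n) / (2 + 3 * harmonic n)) * (1 - 2 * harmonic n))
    @[n --> \oo] --> (expR (pi / 2) : R).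
Proof.
have ch := @cvg_harmonic R.
have -> : expR (pi / 2) = expR (pi * cos 0 / (2 + 3 * 0)) * (1 - 2 * 0) :> R.
  by rewrite cos0 !mulr0 addr0 subr0 !mulr1.
apply: cvgM; last by apply: cvgB; [exact: cvg_cst|exact: cvgMr].
apply: (@cvg_comp _ _ _ _ expR); last exact: continuous_expR.
apply: cvgM.
  by apply: cvgMr; apply: (@cvg_comp _ _ _ _ cos); [exact: ch|exact: continuous_cos].
apply: cvgV; first by rewrite mulr0 addr0.
by apply: cvgD; [exact: cvg_cst|exact: cvgMr].
Qed.

(** In dimension d = q^4 + q^3 and at time q^4 the product of rate and time is
    almost pi / 2, since q^4 / (2 d + 1) is almost 1 / 2. *)
Lemma volterra_gap_rate {R : realType} (q : nat) : (0 < q)%N ->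
  pi * cos (q%:R^-1) / (2 + 3 * q%:R^-1) <=
  volterra_gap (q ^ 4 + q ^ 3) * (q ^ 4)%:R :> R.
Proof.
move=> q0; set d := (q ^ 4 + q ^ 3)%N; set e : R := q%:R^-1.
have qR : 0 < q%:R :> R by rewrite ltr0n.
have e0 : 0 < e by rewrite invr_gt0.
have e1 : e <= 1 by rewrite invf_le1 // ler1n.
have pi0 := @pi_gt0 R; have pi4 : pi <= 4 :> R.
  by have := @pihalf_lt2 R; lra.
rewrite /volterra_gap; set y := _ / 2.
have D0 : 0 < (2 * d + 1)%:R :> R by rewrite ltr0n addn1.
have y0 : 0 < y by rewrite !divr_gt0.
have dq : (q <= d)%N.
  by rewrite /d (leq_trans _ (leq_addr _ _)) // -[X in (X <= _)%N]expn1 leq_pexp2l.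
have ye : y <= e.
  rewrite /y /e -[leRHS]div1r ler_pdivrMr // ler_pdivrMr //.
  rewrite mul1r -mulrA ler_pdivlMl //.
  apply: (@le_trans _ _ (q%:R * 4)); first by rewrite ler_pM2l.
  by rewrite -!natrM ler_nat; lia.
have ypi : 0 <= y <= pi / 2.
  by have := @pihalf_ge1 R => p1; apply/andP; split; lra.
have /andP[hy _] := sin_bounds ypi.
have ce : cos e <= cos y.
  have [->//|ne] := eqVneq y e.
  have yle : y < e by rewrite lt_neqAle ne ye.
  have h1 : y \in `[0, pi] by rewrite in_itv /= ltW //=; have := @pi_ge2 R; lra.
  have h2 : e \in `[0, pi] by rewrite in_itv /= ltW //=; have := @pi_ge2 R; lra.
  by rewrite ltW // ltr_cos.
have ce0 : 0 <= cos e.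
  by apply: cos_ge0_pihalf; have := @pihalf_ge1 R => p1; apply/andP; split; lra.
apply: (@le_trans _ _ (2 * (y * cos e) * (q ^ 4)%:R)); last first.
  rewrite ler_wpM2r // ler_wpM2l // (le_trans _ hy) // ler_wpM2l // ltW //.
have -> : 2 * (y * cos e) * (q ^ 4)%:R = pi * cos e * ((q ^ 4)%:R / (2 * d + 1)%:R).
  by rewrite /y; field; rewrite gt_eqF.
rewrite ler_wpM2l ?mulr_ge0 ?(ltW pi0) //.
rewrite ler_pdivlMr // ler_pdivrMl; last by lra.
have -> : (2 + 3 * e) * (q ^ 4)%:R = (2 * q ^ 4 + 3 * q ^ 3)%:R.
  by rewrite natrD (natrM _ 2) (natrM _ 3) !natrX /e; field; rewrite gt_eqF.
by rewrite ler_nat /d mulnDr -addnA leq_add2l (mulSn 2) addnC leq_add2r expn_gt0 q0.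
Qed.

(** * Finite-dimensional complex Hilbert spaces *)

(** An alias is needed because row vectors already carry the maximum norm. *)
Definition euclidean (R : realType) (d : nat) : Type := 'rV[R[i]]_d.

Section Euclidean.
Context (R : realType) (d : nat).
Local Notation V := (euclidean R d).

HB.instance Definition _ := GRing.Lmodule.copy V 'rV[R[i]]_d.

Definition euclidean_norm (u : V) : R[i] := sqrtC (dotmx (u : 'rV[R[i]]_d) u).

Lemma euclidean_normD (u v : V) :
  euclidean_norm (u + v) <= euclidean_norm u + euclidean_norm v.
Proof. exact: (triangle_lerif (@dotmx R[i] d) u v). Qed.

Lemma euclidean_normZ (a : R[i]) (u : V) :
  euclidean_norm (a *: u) = `|a| * euclidean_norm u.
Proof.
rewrite /euclidean_norm (dnormZ (@dotmx R[i] d)) sqrtCM ?nnegrE ?exprn_ge0 //.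
by rewrite sqrCK.
Qed.

Lemma euclidean_norm0 (u : V) : euclidean_norm u = 0 -> u = 0.
Proof.
by move=> /eqP; rewrite /euclidean_norm sqrtC_eq0 (dnorm_eq0 (@dotmx R[i] d)) => /eqP.
Qed.

HB.instance Definition _ := @Lmodule_isNormed.Build R[i] V euclidean_norm
  euclidean_normD euclidean_normZ euclidean_norm0.


Lemma euclidean_normE (u : V) : `|u| = euclidean_norm u.
Proof. by []. Qed.

Lemma euclidean_norm_sqr (u : V) : `|u| ^+ 2 = \sum_j `|u 0 j| ^+ 2.
Proof.
rewrite euclidean_normE sqrtCK dotmxE mxE; apply: eq_bigr => j _.
by rewrite !mxE normCK.
Qed.

Lemma entry_le_norm (u : V) j : `|u 0 j| <= `|u|.
Proof.
rewrite -(@ler_pXn2r _ 2) ?nnegrE // euclidean_norm_sqr (bigD1 j) //= lerDl.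
by apply: sumr_ge0 => k _; rewrite exprn_ge0.
Qed.

Lemma norm_le_sum (u : V) : `|u| <= \sum_j `|u 0 j|.
Proof.
have {1}-> : u = \sum_j (u 0 j *: (delta_mx 0 j : V)) by rewrite [LHS]row_sum_delta.
apply: le_trans (ler_norm_sum _ _ _) _; apply: ler_sum => j _.
rewrite normrZ ler_piMr //.
rewrite -(@expr_le1 _ 2) // euclidean_norm_sqr (bigD1 j) //= big1 => [|k kj].
  by rewrite mxE !eqxx normr1 expr1n addr0.
by rewrite mxE (negbTE kj) andbF normr0 expr0n.
Qed.

(** Real and imaginary parts of the coordinates of a Cauchy filter converge. *)
Lemma euclidean_complete (F : set_system V) : ProperFilter F -> cauchy F -> cvg F.
Proof.
move=> FF /cauchy_ballP Fc.
have part (p : R[i] -> R) : (forall x y, `|p x - p y|%:C <= `|x - y|) ->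
    forall j, cvg ((fun u : V => p (u 0 j)) @ F).
  move=> hp j; apply: cauchy_cvg; apply/cauchy_ballP => e e0.
  have eC : 0 < e%:C by rewrite ltcR.
  rewrite near_map2; apply: filterS (Fc _ eC) => -[u v] /=.
  rewrite -!ball_normE /= => huv; rewrite -ltcR.
  apply: le_lt_trans huv; apply: le_trans (hp _ _) _.
  by have := entry_le_norm (u - v) j; rewrite !mxE.
have cRe : forall j, cvg ((fun u : V => complex.Re (u 0 j)) @ F).
  by apply: part => x y; rewrite -raddfB normc_ge_Re.
have cIm : forall j, cvg ((fun u : V => complex.Im (u 0 j)) @ F).
  apply: part => x y; rewrite -raddfB -normrN -ReiNIm.
  by apply: le_trans (normc_ge_Re _) _; rewrite normrM complexiE normCi mulr1.
pose l : V := \row_j (lim ((fun u : V => complex.Re (u 0 j)) @ F) +i*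
                     lim ((fun u : V => complex.Im (u 0 j)) @ F)).
apply/cvg_ex; exists l; apply/cvgrPdist_lt => e e0.
have eE : e = (complex.Re e)%:C by rewrite RRe_real // gtr0_real.
have e1 : 0 < complex.Re e by rewrite -ltcR -eE.
pose c := complex.Re e / (2 * d.+1%:R).
have c0 : 0 < c by rewrite divr_gt0 ?mulr_gt0 ?ltr0n.
have hRe : \forall u \near F, forall j, `|complex.Re (l 0 j) - complex.Re ((u : V) 0 j)| < c.
  apply: filter_forall => j; rewrite mxE /=.
  by move/cvgrPdist_lt : (cRe j); apply.
have hIm : \forall u \near F, forall j, `|complex.Im (l 0 j) - complex.Im ((u : V) 0 j)| < c.
  apply: filter_forall => j; rewrite mxE /=.
  by move/cvgrPdist_lt : (cIm j); apply.
apply: filterS2 hRe hIm => u uRe uIm; apply: le_lt_trans (norm_le_sum _) _.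
apply: (@le_lt_trans _ _ (\sum_(j < d) (2 * c)%:C)).
  apply: ler_sum => j _.
  have -> : (l - u) 0 j = (complex.Re (l 0 j) - complex.Re (u 0 j))%:C +
       'i%C * (complex.Im (l 0 j) - complex.Im (u 0 j))%:C.
    by rewrite !mxE [LHS]complexE !raddfB.
  apply: le_trans (ler_normD _ _) _.
  rewrite normrM complexiE normCi mul1r !normc_def /= !expr0n !addr0 !sqrtr_sqr -rmorphD lecR.
  by rewrite mulr_natl mulr2n lerD // ltW.
rewrite sumr_const card_ord -rmorphMn eE ltcR -mulr_natl.
have -> : 2 * c = complex.Re e / d.+1%:R.
  by rewrite /c invfM mulrCA mulVKf // pnatr_eq0.
by rewrite mulrCA gtr_pMr // ltr_pdivrMr ?ltr0n // mul1r ltr_nat.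
Qed.

HB.instance Definition _ := Uniform_isComplete.Build V euclidean_complete.

End Euclidean.

(** * The truncated shift and its generator *)

Section Shift.
Context {R : realType} (n : nat).
Local Notation d := n.+1.
Local Notation V := (euclidean R d).
Local Notation normc := Normc.normc.
Implicit Types u v : V.

Lemma normc_ge0 (x : R[i]) : 0 <= normc x.
Proof. by case: x => a b; exact: sqrtr_ge0. Qed.

(** Coordinates extended by zero, so that shifted indices need no bound. *)
Definition entry u (k : nat) : R[i] := (rVpoly (u : 'rV_d))`_k.

Lemma entry_ord u (j : 'I_d) : entry u j = u 0 j.
Proof. exact: coef_rVpoly_ord. Qed.

Lemma entry_ge u k : (d <= k)%N -> entry u k = 0.
Proof. by move=> dk; rewrite /entry coef_rVpoly insubN // -leqNgt. Qed.

Lemma entryB u v k : entry (u - v) k = entry u k - entry v k.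
Proof. by rewrite /entry !coef_rVpoly; case: insub => [j|]; rewrite ?mxE ?subr0. Qed.

Lemma entryZ (a : R[i]) u k : entry (a *: u) k = a * entry u k.
Proof. by rewrite /entry !coef_rVpoly; case: insub => [j|]; rewrite ?mxE ?mulr0. Qed.

Lemma nrm_sqrE u : nrm u ^+ 2 = \sum_(j < d) normc (entry u j) ^+ 2.
Proof.
apply: (@complexI R); rewrite rmorphXn rmorph_sum /= -nrmE euclidean_norm_sqr.
by apply: eq_bigr => j _; rewrite rmorphXn entry_ord.
Qed.

Definition shift_mx : 'M[R[i]]_d := \matrix_(i, j) (j == i.+1 :> nat)%:R.

Lemma entry_shift u k : entry (u *m shift_mx : V) k =
  if k is k'.+1 then (if (k < d)%N then entry u k' else 0) else 0.
Proof.
have [kd|dk] := ltnP k d; last by rewrite entry_ge //; case: k dk.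
rewrite (entry_ord _ (Ordinal kd)) mxE; case: k kd => [|k] kd.
  by apply: big1 => i _; rewrite mxE mulr0.
rewrite (bigD1 (Ordinal (ltnW kd))) //= mxE eqxx mulr1 big1 ?addr0.
  by rewrite -[LHS]entry_ord.
move=> i ik; rewrite mxE /= eqSS eq_sym.
by rewrite (_ : (_ == _) = false) ?mulr0 //; apply: contraNF ik => /eqP ik; apply/eqP/val_inj.
Qed.

Lemma entry_shiftX u m k : entry (u *m shift_mx ^+ m : V) k =
  if (m <= k < d)%N then entry u (k - m) else 0.
Proof.
elim: m k => [|m IH] k.
  rewrite expr0 mulmx1 subn0 /=; case: ltnP => // dk; exact: entry_ge.
rewrite exprSr -mulmxE mulmxA entry_shift.
case: k => [|k] //; rewrite IH subSS.
case: ifP => kd.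
  by rewrite (ltnW kd) !andbT.
by rewrite andbF.
Qed.

Lemma nrm_shift u : nrm (u *m shift_mx : V) <= nrm u.
Proof.
rewrite -nrm_sqr_le !nrm_sqrE.
rewrite big_ord_recl entry_shift Normc.normc0 expr0n add0r.
rewrite [leRHS]big_ord_recr /= -[leLHS]addr0 lerD ?sqr_ge0 //.
by apply: ler_sum => j _; rewrite entry_shift ltnS ltn_ord.
Qed.

Lemma nrm_shiftX u m : nrm (u *m shift_mx ^+ m : V) <= nrm u.
Proof.
elim: m => [|m IH]; first by rewrite expr0 mulmx1.
by rewrite exprSr -mulmxE mulmxA (le_trans (nrm_shift _)).
Qed.

Lemma shift_nilp m : (d <= m)%N -> shift_mx ^+ m = 0.
Proof.
move=> dm; apply/row_matrixP => i; rewrite row0 rowE; apply/rowP => j.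
rewrite -[LHS](entry_ord (delta_mx 0 i *m _ : V)) entry_shiftX mxE.
by rewrite leqNgt (leq_trans (ltn_ord j) dm).
Qed.

(** This is exp (t (N - 1)): the omitted powers of N vanish. *)
Definition shift_semigroup_mx (t : R) : 'M[R[i]]_d :=
  \sum_(k < d.+1) (poisson_weight k t)%:C *: shift_mx ^+ k.

Definition shift_semigroup (t : R) : {linear V -> V} := mulmxr (shift_semigroup_mx t).

Lemma shift_semigroupE t u : shift_semigroup t u =
  \sum_(k < d.+1) (poisson_weight k t)%:C *: (u *m shift_mx ^+ k : V).
Proof.
by rewrite /= /shift_semigroup_mx mulmx_sumr; apply: eq_bigr => k _; rewrite -scalemxAr.
Qed.

Lemma shift_domain_linear (a : R[i]) u v : setT u -> setT v -> setT (a *: u + v).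
Proof. by []. Qed.

Definition shift_generator_fun u : V := u *m shift_mx - u.

Lemma shift_generator_linear (a : R[i]) u v : setT u -> setT v ->
  shift_generator_fun (a *: u + v) =
  a *: shift_generator_fun u + shift_generator_fun v.
Proof.
move=> _ _; rewrite /shift_generator_fun mulmxDl -scalemxAl scalerBr.
by rewrite opprD addrACA.
Qed.

Definition shift_generator : operator V :=
  @Operator R V setT shift_generator_fun I shift_domain_linear shift_generator_linear.


Local Notation A := shift_generator.
Local Notation S := shift_semigroup.

Lemma nrm_generator_le u : nrm (A u) <= 2 * nrm u.
Proof.
rewrite /= /shift_generator_fun; apply: le_trans (nrmD _ _) _.
by rewrite nrmN mulr_natl mulr2n lerD2r nrm_shift.
Qed.

Lemma generatorB u v : A (u - v) = A u - A v.
Proof. exact: opfunB. Qed.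

Lemma generator_continuous : continuous (A : V -> V).
Proof.
move=> u; apply/(@cvg_nrmP R V V (nbhs u)) => e e0.
have e2 : 0 < e / 2 by rewrite divr_gt0.
have /(@cvg_nrmP R V V (nbhs u))/(_ _ e2) : (fun v : V => v) @ nbhs u --> u by exact: cvg_id.
apply: filterS => v huv; rewrite -generatorB.
by apply: le_lt_trans (nrm_generator_le _) _; rewrite mulrC -ltr_pdivlMr.
Qed.

Lemma generator_closed : closed_operator A.
Proof.
rewrite /closed_operator; pose f (p : V * V) : V := p.2 - A p.1.
have -> : [set p : V * V | opdom A p.1 /\ p.2 = A p.1] = f @^-1` [set 0].
  apply/seteqP; split => p /=; rewrite /f.
    by move=> [_ ->]; rewrite subrr.
  by move=> /eqP; rewrite subr_eq0 => /eqP.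
apply: preimage_closed.
  move=> p _; apply: cvgB; first exact: cvg_snd.
  by apply: continuous_comp; [exact: cvg_fst|exact: generator_continuous].
apply: accessible_closed_set1; apply: hausdorff_accessible; exact: norm_hausdorff.
Qed.

Definition euclidean_dot : {dot V for Num.conj} := @dotmx R[i] d.

Lemma euclidean_hilbert : hilbert_product euclidean_dot.
Proof. by move=> u; rewrite euclidean_normE sqrtCK. Qed.

Lemma generator_accretive u : 0 <= complex.Re (euclidean_dot (- A u) u).
Proof.
have -> : - A u = u - (u *m shift_mx : V) by rewrite /= /shift_generator_fun opprB.
by apply: contraction_accretive; [exact: euclidean_hilbert|exact: nrm_shift].
Qed.

(** Since |z + 1| >= 1, the moduli of the coordinates of u have increments bounded
    by those of z u - A u; thus z = 0 is the worst case. *)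
Lemma shift_volterra_bound (z : R[i]) u : 0 <= complex.Re z ->
  volterra_gap d * nrm u <= nrm (z *: u - A u).
Proof.
move=> z0; have c0 : 0 < volterra_gap d :> R by exact: volterra_gap_gt0.
set f : V := z *: u - A u.
apply: nrm_scaled_le; first exact: ltW; rewrite !nrm_sqrE.
have z1 : 1 <= normc (z + 1).
  rewrite -lecR; apply: le_trans (normc_ge_Re (z + 1)).
  by rewrite lecR raddfD /= ger0_norm ?addr_ge0 // lerDr.
have fE : f = (z + 1) *: u - (u *m shift_mx : V).
  by rewrite /f /= /shift_generator_fun opprB addrA scalerDl scale1r addrAC.
have entryf k : entry f k = (z + 1) * entry u k - entry (u *m shift_mx : V) k.
  by rewrite fE entryB entryZ.
have nle k : normc (entry u k) <= normc ((z + 1) * entry u k).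
  by rewrite Normc.normcM ler_peMl // normc_ge0.
apply: (@volterra_bound R d (ltn0Sn n) (fun k => normc (entry u k)) (fun k => normc (entry f k))).
- by move=> j; exact: normc_ge0.
- by move=> j; exact: normc_ge0.
- by rewrite entryf entry_shift subr0 nle.
- move=> j; rewrite entryf entry_shift; case: ifP => jd; last first.
    rewrite entry_ge ?Normc.normc0; last by rewrite leqNgt jd.
    by rewrite addr_ge0 ?normc_ge0.
  apply: le_trans (nle _) _.
  have := le_normcD (entry u j) ((z + 1) * entry u j.+1 - entry u j).
  by rewrite (addrC (entry u j)) subrK.
Qed.

(** In finite dimension the lower bound gives invertibility. *)
Lemma generator_surjective (z : R[i]) v : 0 <= complex.Re z ->
  exists2 u, opdom A u & z *: u - A u = v.
Proof.
move=> z0; pose M : 'M[R[i]]_d := (z + 1)%:M - shift_mx.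
have ME u : (u *m M : V) = z *: u - A u.
  rewrite /M mulmxBr mul_mx_scalar /= /shift_generator_fun opprB addrA.
  by rewrite scalerDl scale1r addrAC.
have MU : M \in unitmx.
  rewrite -row_free_unit; apply: inj_row_free => u Mu0.
  have := shift_volterra_bound u z0; rewrite -ME Mu0 nrm0.
  rewrite pmulr_rle0 ?volterra_gap_gt0 // => h.
  by apply/eqP; rewrite -(@nrm_eq0 R V) eq_le h nrm_ge0.
by exists (v *m invmx M) => //; rewrite -ME mulmxKV.
Qed.

Lemma generator_m_accretive : opp_m_accretive euclidean_dot A.
Proof.
split; first exact: generator_closed.
- by move=> O [u Ou] _; exists u.
- by move=> u _; exact: generator_accretive.
- move=> l l0 v; apply: generator_surjective; exact: ltW.
Qed.

Lemma volterra_gap_le_rA0 : volterra_gap d <= rA0 A.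
Proof.
apply: rA0_ge; first exact: volterra_gap_gt0.
  exists (const_mx 1 : V); apply/eqP => /rowP/(_ 0); rewrite !mxE => /eqP.
  by rewrite oner_eq0.
move=> z z0; split=> [v|u _]; first exact: generator_surjective (ltW z0).
exact: shift_volterra_bound (ltW z0).
Qed.

End Shift.

(** * The Poisson shift semigroup *)

(** At time 0 the weights have derivative - 1 for k = 0, 1 for k = 1, and 0
    otherwise; the error is of first order in h. *)
Lemma poisson_weight_derivative {R : realType} (k : nat) (h : R) : 0 < h <= 1 ->
  `|h^-1 * (poisson_weight k h - (k == 0)%:R) - ((k == 1)%:R - (k == 0)%:R)| <= h.
Proof.
move=> /andP[h0 h1]; rewrite /poisson_weight; set E := expR (- h).
have E1 : 1 - h <= E by exact: expR_ge1Dx.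
have E2 : E * (1 + h) <= 1.
  rewrite -[leRHS](@expR0 R) -(addNr h) expRD ler_pM2l ?expR_gt0 //.
  exact: expR_ge1Dx.
have E0 : 0 < E by exact: expR_gt0.
case: k => [|[|k]] /=.
- rewrite expr0 fact0 divr1 mulr1 sub0r opprK.
  have -> : h^-1 * (E - 1) + 1 = h^-1 * (E - 1 + h) by field; rewrite gt_eqF.
  rewrite normrM gtr0_norm ?invr_gt0 // ler_pdivrMl // ger0_norm; last by lra.
  nra.
- rewrite expr1 (_ : 1`! = 1)%N // divr1 !subr0 mulrCA mulVf ?gt_eqF // mulr1 ler_norml; nra.
- have f1 : 1 <= (k.+2)`!%:R :> R by rewrite ler1n fact_gt0.
  have X0 : 0 <= h ^+ k.+2 / (k.+2)`!%:R by rewrite divr_ge0 ?exprn_ge0 // ltW.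
  have hk : h ^+ k.+2 <= h * h.
    rewrite 2!exprS mulrA; apply: ler_piMr; first by rewrite -expr2 sqr_ge0.
    by rewrite exprn_ile1 // ltW.
  rewrite !subr0 ger0_norm; last by rewrite (mulr_ge0 _ (mulr_ge0 (ltW E0) X0)) // invr_ge0 ltW.
  rewrite ler_pdivrMl //; apply: (@le_trans _ _ (h ^+ k.+2 / (k.+2)`!%:R)).
    by apply: ler_piMl => //; nra.
  rewrite ler_pdivrMr ?(lt_le_trans ltr01) //; apply: le_trans hk _.
  by apply: ler_peMr; rewrite // -expr2 sqr_ge0.
Qed.

Section ShiftSemigroup.
Context {R : realType} (n : nat).
Local Notation d := n.+1.
Local Notation V := (euclidean R d).
Local Notation N := (@shift_mx R n).
Local Notation A := (@shift_generator R n).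
Local Notation S := (@shift_semigroup R n).
Implicit Types u v : V.

(** The semigroup is the value at N of these polynomials, and multiples of
    X^(d + 1) vanish at N: the semigroup law is an identity between low-degree
    coefficients. *)
Definition poisson_poly (t : R) : {poly R[i]} := \poly_(k < d.+1) (poisson_weight k t)%:C.

Lemma horner_poisson (t : R) : horner_mx N (poisson_poly t) = shift_semigroup_mx n t.
Proof.
rewrite /poisson_poly poly_def linear_sum; apply: eq_bigr => k _.
by rewrite linearZ /= rmorphXn /= horner_mx_X.
Qed.

Lemma shift_semigroup_mxD (s t : R) :
  shift_semigroup_mx n (s + t) = shift_semigroup_mx n s * shift_semigroup_mx n t.
Proof.
rewrite -!horner_poisson -rmorphM.
rewrite -[X in _ = horner_mx N X](poly_take_drop d.+1) rmorphD rmorphM rmorphXn /=.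
rewrite horner_mx_X shift_nilp ?leqnSn // mulr0 addr0; congr (horner_mx N _).
apply/polyP => k; rewrite coef_poly coef_take_poly; case: ltnP => // kd.
rewrite coefM -poisson_weightD rmorph_sum; apply: eq_bigr => i _.
rewrite !coef_poly (leq_ltn_trans (leq_subr _ _) kd).
by rewrite (leq_ltn_trans _ kd) ?rmorphM // -ltnS.
Qed.

Lemma shift_semigroup_mx0 : shift_semigroup_mx n (0 : R) = 1%:M :> 'M[R[i]]_d.
Proof.
rewrite /shift_semigroup_mx big_ord_recl big1 ?addr0 => [|k _].
  by rewrite /poisson_weight oppr0 expR0 !expr0 fact0 divr1 mulr1 rmorph1 scale1r.
by rewrite /poisson_weight exprS mul0r mul0r mulr0 rmorph0 scale0r.
Qed.

Lemma shift_semigroupD s t u : S (s + t) u = S s (S t u).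
Proof. by rewrite /= addrC shift_semigroup_mxD -mulmxE mulmxA. Qed.

Lemma shift_semigroup0 u : S 0 u = u.
Proof. by rewrite /= shift_semigroup_mx0 mulmx1. Qed.

Lemma shift_semigroup_contr t u : 0 <= t -> nrm (S t u) <= nrm u.
Proof.
move=> t0; rewrite shift_semigroupE.
apply: le_trans (nrm_sum _ (fun k => (poisson_weight k t)%:C *: (u *m N ^+ k : V))) _.
apply: (@le_trans _ _ (\sum_(k < d.+1) poisson_weight k t * nrm u)).
  apply: ler_sum => k _; rewrite nrmZr (ger0_norm (poisson_weight_ge0 k t0)).
  by apply: ler_wpM2l; [exact: poisson_weight_ge0|exact: nrm_shiftX].
rewrite -mulr_suml; apply: ler_piMl; first exact: nrm_ge0.
exact: poisson_sum_le1.
Qed.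

Lemma shift_generator_estimate (h : R) u : 0 < h <= 1 ->
  nrm (h^-1%:C *: (S h u - u) - A u) <= h * (d.+1%:R * nrm u).
Proof.
move=> h01.
pose a k : R := h^-1 * (poisson_weight k h - (k == 0)%:R) - ((k == 1)%:R - (k == 0)%:R).
have u0 : u = \sum_(k < d.+1) ((k == 0 :> nat)%:R : R)%:C *: (u *m N ^+ k : V).
  rewrite big_ord_recl big1 ?addr0 => [|k _]; last by rewrite rmorph0 scale0r.
  by rewrite expr0 mulmx1 rmorph1 scale1r.
have u1 : (u *m N : V) = \sum_(k < d.+1) ((k == 1 :> nat)%:R : R)%:C *: (u *m N ^+ k : V).
  rewrite big_ord_recl rmorph0 scale0r add0r big_ord_recl big1 ?addr0 => [|k _].
    by rewrite expr1 rmorph1 scale1r.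
  by rewrite rmorph0 scale0r.
have -> : h^-1%:C *: (S h u - u) - A u = \sum_(k < d.+1) (a k)%:C *: (u *m N ^+ k : V).
  rewrite shift_semigroupE [in LHS]/= /shift_generator_fun u1 {2 4}u0 -!sumrB scaler_sumr -sumrB.
  apply: eq_bigr => k _; rewrite -!scalerBl scalerA -scalerBl.
  congr (_ *: _); rewrite /a; move: (poisson_weight k h) => p.
  by rewrite !(rmorphB, rmorphM) /=.
apply: le_trans (nrm_sum _ (fun k => (a k)%:C *: (u *m N ^+ k : V))) _.
have -> : h * (d.+1%:R * nrm u) = \sum_(k < d.+1) h * nrm u.
  by rewrite sumr_const card_ord -[RHS]mulr_natl mulrCA.
apply: ler_sum => k _; rewrite nrmZr; apply: ler_pM => //; first exact: nrm_ge0.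
  exact: poisson_weight_derivative.
exact: nrm_shiftX.
Qed.

Lemma shift_generatorP : generator S A.
Proof.
have cvgA u : (fun h : R => h^-1%:C *: (S h u - u)) @ 0^'+ --> A u.
  apply/cvg_nrmP => e e0.
  have k0 : 0 < d.+1%:R * nrm u + 1 by rewrite ltr_wpDl // mulr_ge0 // nrm_ge0.
  near=> h.
  have h0 : 0 < h by near: h; exact: nbhs_right_gt.
  have h01 : 0 < h <= 1 by rewrite h0 ltW //; near: h; exact: nbhs_right_lt.
  rewrite nrmB; apply: le_lt_trans (shift_generator_estimate u h01) _.
  apply: (@lt_le_trans _ _ (h * (d.+1%:R * nrm u + 1))); first by rewrite ltr_pM2l // ltrDl.
  rewrite -ler_pdivlMr // ltW //; near: h; apply: nbhs_right_lt.
  by rewrite divr_gt0.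
move=> u v; split=> [[_ <-]|hv]; first exact: cvgA.
by split=> //; apply: (cvg_unique _ (cvgA u) hv); exact: norm_hausdorff.
Unshelve. all: by end_near.
Qed.

Lemma shift_semigroup_near_id (h : R) u : 0 <= h <= 1 ->
  nrm (S h u - u) <= h * (d.+1%:R * nrm u + nrm (A u)).
Proof.
move=> /andP[]; rewrite le_eqVlt => /predU1P[<- _|h0 h1].
  by rewrite shift_semigroup0 subrr nrm0 mul0r.
have h01 : 0 < h <= 1 by rewrite h0.
have -> : S h u - u = h%:C *: ((h^-1%:C *: (S h u - u) - A u) + A u).
  by rewrite subrK scalerA -rmorphM divff ?gt_eqF // scale1r.
rewrite nrmZr (gtr0_norm h0) ler_pM2l //; apply: le_trans (nrmD _ _) _.
rewrite lerD2r; apply: le_trans (shift_generator_estimate u h01) _.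
by apply: ler_piMl; rewrite // mulr_ge0 // nrm_ge0.
Qed.

Lemma shift_semigroup_continuous u :
  {within [set t : R | 0 <= t], continuous (fun t => S t u)}.
Proof.
apply/subspace_continuousP => s /= s0; apply/cvg_nrmP => e e0.
pose B := d.+1%:R * nrm u + nrm (A u) + 1.
have B0 : 0 < B by rewrite ltr_wpDl // addr_ge0 ?nrm_ge0 // mulr_ge0 // nrm_ge0.
have est x y : 0 <= x -> x <= y -> y - x < 1 -> y - x < e / B -> nrm (S x u - S y u) < e.
  move=> x0 xy xy1 xye.
  have -> : S y u = S x (S (y - x) u) by rewrite -shift_semigroupD addrC subrK.
  have -> : S x u - S x (S (y - x) u) = S x (u - S (y - x) u) by rewrite raddfB.
  apply: le_lt_trans (shift_semigroup_contr _ x0) _.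
  rewrite nrmB; apply: le_lt_trans (shift_semigroup_near_id _ _) _.
    by rewrite subr_ge0 xy ltW.
  apply: (@le_lt_trans _ _ ((y - x) * B)); last by rewrite -ltr_pdivlMr.
  by rewrite ler_wpM2l ?subr_ge0 // lerDl.
have c0 : 0 < Num.min 1 (e / B) by rewrite lt_min ltr01 divr_gt0.
have : \forall t \near s, `|s - t| < Num.min 1 (e / B).
  by have /cvgrPdist_lt := (@cvg_id _ (nbhs s)); apply.
apply: filterS => t; rewrite lt_min => /andP[t1 te] /= t0.
have [st|ts] := leP s t.
  by move: t1 te; rewrite distrC ger0_norm ?subr_ge0 // => t1 te; exact: est.
move: t1 te; rewrite ger0_norm ?subr_ge0 ?(ltW ts) // => t1 te.
by rewrite nrmB; apply: est => //; exact: ltW.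
Qed.

Lemma shift_semigroup_of : semigroup_of A S.
Proof.
split; last exact: shift_generatorP.
split=> //.
- exact: shift_semigroup0.
- by move=> s t _ _ u; exact: shift_semigroupD.
- exact: shift_semigroup_continuous.
- by move=> t t0 u; rewrite !nrmE lecR; exact: shift_semigroup_contr.
Qed.

End ShiftSemigroup.

(** * The shift semigroup stays close to norm one *)

Lemma sum_ltn_le (m c : nat) : (\sum_(i < m) (i < c)%N <= c)%N.
Proof.
suff -> : (\sum_(i < m) (i < c) = minn m c)%N by exact: geq_minr.
by elim: m => [|m IH]; rewrite ?big_ord0 ?min0n // big_ord_recr /= IH; lia.
Qed.

(** The window of length m at a and its translate to k overlap in at least
    m - |k - a| points. *)
Lemma overlap_count (a k m : nat) :
  (m <= \sum_(i < m) ((k <= a + i) && (a + i - k < m))%N + ((k - a) + (a - k)))%N.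
Proof.
have h1 := sum_ltn_le m (k - a).
have h2 : (\sum_(i < m) (k + m <= a + i)%N <= a - k)%N.
  apply: leq_trans (sum_ltn_le m (a - k)).
  rewrite (reindex_inj rev_ord_inj) /=; apply: leq_sum => i _.
  by have := ltn_ord i; lia.
apply: (@leq_trans (\sum_(i < m) (((k <= a + i) && (a + i - k < m))%N +
    ((i < k - a) + (k + m <= a + i)))%N)).
  rewrite -[X in (X <= _)%N](card_ord m) -sum1_card; apply: leq_sum => i _.
  by have := ltn_ord i; lia.
by rewrite !big_split /= leq_add2l leq_add.
Qed.

Section ShiftNorm.
Context {R : realType} (n b m : nat) (b_gt0 : (0 < b)%N).
Hypothesis dE : n.+1 = (b ^ 2 + m)%N.
Local Notation V := (euclidean R n.+1).
Local Notation a := (b ^ 2)%N.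
Let t : R := a%:R.

(** At time b^2 this vector has moved by about b^2, to the last m coordinates, with
    only its ends, of length about b, blurred. *)
Definition plateau : V := \row_j (j < m)%:R.

Lemma entry_plateau k : entry plateau k = (k < m)%:R.
Proof.
have [kd|dk] := ltnP k n.+1; first by rewrite (entry_ord _ (Ordinal kd)) mxE.
by rewrite entry_ge // ltnNge (leq_trans _ dk) // dE leq_addl.
Qed.

Lemma sqr_normc_real (x : R) : Normc.normc x%:C ^+ 2 = x ^+ 2.
Proof. by rewrite /= expr0n addr0 sqr_sqrtr ?sqr_ge0. Qed.

Lemma nrm_plateau : nrm plateau ^+ 2 = m%:R.
Proof.
rewrite nrm_sqrE (eq_bigr (fun j : 'I_n.+1 => (j < m)%:R)); last first.
  move=> j _; rewrite entry_plateau -(rmorph_nat (real_complex R)) sqr_normc_real.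
  by case: (_ < _)%N; rewrite ?expr1n ?expr0n.
rewrite -(big_mkord xpredT (fun j => (j < m)%:R)) dE addnC big_mkord big_split_ord /=.
rewrite (eq_bigr (fun=> 1)) => [|i _]; last by rewrite ltn_ord.
rewrite [X in _ + X]big1 ?addr0 => [|i _]; last by rewrite ltnNge leq_addr.
by rewrite sumr_const card_ord.
Qed.

Let s j : R := \sum_(k < n.+2) poisson_weight k t * ((k <= j) && (j - k < m))%N%:R.

Lemma entry_shifted_plateau j : (j < n.+1)%N ->
  entry (shift_semigroup n t plateau) j = (s j)%:C.
Proof.
move=> jd; rewrite (entry_ord _ (Ordinal jd)) shift_semigroupE summxE rmorph_sum.
apply: eq_bigr => k _.
rewrite mxE -[X in _ * X](entry_ord (plateau *m _ : V)) entry_shiftX /= jd andbT.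
rewrite entry_plateau [RHS]rmorphM; congr (_ * _); rewrite [RHS]rmorph_nat.
by case: (k <= j)%N.
Qed.

(** The mass found in the last m coordinates averages, over the Poisson
    displacement k, the overlap of the window with its translate. *)
Lemma shifted_plateau_mass : m%:R - b%:R <= \sum_(i < m) s (a + i).
Proof.
have hL : (a + m <= n.+2)%N by rewrite -dE.
apply: le_trans (@poisson_tent R _ _ _ b_gt0 hL) _.
rewrite exchange_big /=; apply: ler_sum => k _; rewrite -mulr_sumr.
apply: ler_wpM2l; first by rewrite poisson_weight_ge0.
have := overlap_count a k m; rewrite -(ler_nat R) natrD natr_sum -/t => h.
rewrite lerBlDr; apply: le_trans h _; rewrite lerD2l natrD.
have [ka|ak] := leqP k a.
  rewrite (eqP ka) add0r natrB // distrC; exact: ler_norm.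
rewrite (eqP (ltnW ak)) addr0 natrB ?(ltnW ak) //; exact: ler_norm.
Qed.

(** Here s^2 >= 2 s - 1 replaces the Cauchy-Schwarz inequality on the window. *)
Lemma nrm_shifted_plateau :
  m%:R - 2 * b%:R <= nrm (shift_semigroup n t plateau) ^+ 2.
Proof.
rewrite nrm_sqrE (eq_bigr (fun j : 'I_n.+1 => s j ^+ 2)); last first.
  by move=> j _; rewrite entry_shifted_plateau // sqr_normc_real.
rewrite -(big_mkord xpredT (fun j => s j ^+ 2)) [in X in index_iota _ X]dE.
rewrite big_mkord big_split_ord /=.
apply: (@le_trans _ _ (\sum_(i < m) s (a + i) ^+ 2)); last first.
  by rewrite lerDr; apply: sumr_ge0 => i _; exact: sqr_ge0.
apply: (@le_trans _ _ (\sum_(i < m) (2 * s (a + i) - 1))).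
  rewrite sumrB -mulr_sumr sumr_const card_ord.
  by have := shifted_plateau_mass; lra.
apply: ler_sum => i _; rewrite -subr_ge0.
have -> : s (a + i) ^+ 2 - (2 * s (a + i) - 1) = (s (a + i) - 1) ^+ 2 by ring.
exact: sqr_ge0.
Qed.

Lemma opnorm_shift_ge (c : R) : (0 < m)%N -> 0 <= c <= 1 ->
  c * m%:R <= m%:R - 2 * b%:R -> (c%:E <= opnorm (shift_semigroup n t))%E.
Proof.
move=> m0 /andP[c0 c1] hc.
have mR : 0 < m%:R :> R by rewrite ltr0n.
have sm : 0 < Num.sqrt (m%:R : R) by rewrite sqrtr_gt0.
have su : nrm plateau = Num.sqrt m%:R by rewrite -nrm_plateau sqrtr_sqr ger0_norm ?nrm_ge0.
apply: (@le_opnorm _ _ _ ((Num.sqrt m%:R)^-1%:C *: plateau)).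
  by rewrite nrmZr su gtr0_norm ?invr_gt0 // mulVf // gt_eqF.
rewrite linearZ /= nrmZr gtr0_norm ?invr_gt0 // ler_pdivlMl // mulrC.
rewrite -su; apply: nrm_scaled_le => //; rewrite nrm_plateau.
apply: le_trans nrm_shifted_plateau; apply: le_trans hc.
by rewrite ler_wpM2r ?ler0n // expr2 ler_piMr.
Qed.

End ShiftNorm.


(** * The supremum *)

(** With time q^4, deviation q^2 and window q^3, both the missing part of the
    dimension and the relative blurring are of order 1 / q. *)
Lemma shift_value_ge {R : realType} (q : nat) : (0 < q)%N ->
  ((expR (pi * cos q%:R^-1 / (2 + 3 * q%:R^-1)) * (1 - 2 * q%:R^-1))%:E <=
  (expR (rA0 (@shift_generator R (q ^ 4 + q ^ 3).-1) * (q ^ 4)%:R))%:E *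
   opnorm (@shift_semigroup R (q ^ 4 + q ^ 3).-1 (q ^ 4)%:R))%E.
Proof.
move=> q0; set A := shift_generator _; set S := @shift_semigroup R _.
have qR : 0 < q%:R :> R by rewrite ltr0n.
have dE : (q ^ 4 + q ^ 3).-1.+1 = ((q ^ 2) ^ 2 + q ^ 3)%N.
  by rewrite prednK ?addn_gt0 ?expn_gt0 ?q0 // -expnM.
have [c0|c0] := ltP (1 - 2 * q%:R^-1) (0 : R).
  apply: (@le_trans _ _ 0%E).
    by rewrite lee_fin mulr_ge0_le0 ?expR_ge0 // ltW.
  by apply: mule_ge0; rewrite ?lee_fin ?expR_ge0 // opnorm_ge0.
have q4 : (q ^ 4 = (q ^ 2) ^ 2)%N by rewrite -expnM.
have gapE : volterra_gap (q ^ 4 + q ^ 3) <= rA0 A.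
  rewrite [X in volterra_gap X <= _](_ : _ = (q ^ 4 + q ^ 3).-1.+1); last by rewrite dE -q4.
  exact: volterra_gap_le_rA0.
rewrite EFinM; apply: lee_pmul; rewrite ?lee_fin ?expR_ge0 //.
  rewrite ler_expR; apply: le_trans (volterra_gap_rate q0) _.
  by rewrite ler_wpM2r.
rewrite [X in S X%:R]q4.
apply: (opnorm_shift_ge _ dE); rewrite ?expn_gt0 ?q0 //.
  by rewrite c0 /= lerBlDr lerDl mulr_ge0 ?invr_ge0 ?ltW.
rewrite le_eqVlt; apply/orP; left; apply/eqP.
by rewrite !natrX; field; rewrite gt_eqF.
Qed.

Theorem mainTheorem1 (R : realType) :
  ereal_sup
    [set x : \bar R |
      exists (H : completeNormedModType R[i]) (dot : {dot H for Num.conj})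
             (A : operator H) (S : R -> {linear H -> H}) (t : R),
        [/\ exists v : H, v != 0,
            hilbert_product dot,
            opp_m_accretive dot A,
            semigroup_of A S &
            0 <= t] /\
        x = ((expR (rA0 A * t))%:E * opnorm (S t))%E]
  = (expR (pi / 2))%:E.
Proof.
apply/eqP; rewrite eq_le; apply/andP; split.
  apply: ge_ereal_sup => _ [H [dot [A [S [t [[_ hdot [_ hD _ _] SA t0] ->]]]]]].
  exact: (weighted_opnorm_le hdot SA hD t0).
set X := ereal_sup _.
have lowX q : (0 < q)%N ->
    ((expR (pi * cos q%:R^-1 / (2 + 3 * q%:R^-1)) * (1 - 2 * q%:R^-1))%:E <= X)%E.
  move=> q0; apply: le_trans (shift_value_ge q0) _.
  apply: ereal_sup_ubound.
  exists (euclidean R (q ^ 4 + q ^ 3).-1.+1), (euclidean_dot _).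
  exists (shift_generator _), (@shift_semigroup R _), (q ^ 4)%:R.
  split=> //; split=> //.
  - exists (const_mx 1); apply/eqP => /rowP/(_ 0); rewrite !mxE => /eqP.
    by rewrite oner_eq0.
  - exact: euclidean_hilbert.
  - exact: generator_m_accretive.
  - exact: shift_semigroup_of.
case: X lowX => [x||] lowX; last by have := lowX 1%N isT.
  rewrite lee_fin; apply: (cvgr_to_le optimal_rate_cvg).
  by apply: nearW => k; rewrite -lee_fin; exact: lowX.
exact: leey.
Qed.
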